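(* Fix $\sigma>0$, let $w=\sigma+it$ ($t\in\mathbb{R}$), and define for $z\in\mathbb{C}$ $$G(z)=\int_{-\infty}^{\infty}w^{2z}e^{w^2}\,dt .$$ Then for all $s\in\mathbb{C}$, $$\frac{1}{\Gamma(s)}=\frac{1}{\pi}G\!\left(\tfrac12-s\right)\qquad\text{and}\qquad \Gamma(s)\sin(\pi s)=G\!\left(s-\tfrac12\right).$$ Equivalently, for all $z\in\mathbb{C}$, $G(z)=\cos(\pi z)\Gamma(\tfrac12+z)=\dfrac{\pi}{\Gamma(\tfrac12-z)}$ (interpreted as entire functions).
   Context: Complex powers use the principal branch of the logarithm: $w^{2z}=\exp(2z\log w)$, with branch cut $(-\infty,0]$; since $\operatorname{Re}(w)=\sigma>0$ this is holomorphic along the path. The function $\Gamma(s)\sin(\pi s)$ and $\cos(\pi z)\Gamma(\frac12+z)$ are understood as their entire extensions. *)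

(* Defs.v *)
From HB Require Import structures.
From mathcomp Require Import all_boot all_order all_algebra.
From mathcomp Require Import all_classical all_reals all_analysis.
From mathcomp Require Import complex.

Set Implicit Arguments.
Unset Strict Implicit.
Unset Printing Implicit Defensive.

Import Order.TTheory GRing.Theory Num.Theory.
Import numFieldNormedType.Exports.

Local Open Scope classical_set_scope.
Local Open Scope ring_scope.
Local Open Scope complex_scope.

Section ComplexFunctions.
Variable R : realType.
Local Notation C := R[i].
Local Notation Re := (@complex.Re R).
Local Notation Im := (@complex.Im R).
Local Notation normc := (@ComplexField.Normc.normc R).
Local Notation mu := (@lebesgue_measure R).

Definition expC (z : C) : C :=
  (expR (Re z) * cos (Im z)) +i* (expR (Re z) * sin (Im z)).

(* The principal argument, with values in ]-pi, pi]. *)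
Definition argC (w : C) : R :=
  let a := acos (Re w / normc w) in if 0 <= Im w then a else - a.

(* The value at w = 0 is meaningless. *)
Definition logC (w : C) : C := ln (normc w) +i* argC w.

Definition powC (w a : C) : C := expC (a * logC w).

Definition sinC (z : C) : C := (expC ('i * z) - expC (- ('i * z))) / (2 * 'i).

Definition cosC (z : C) : C := (expC ('i * z) + expC (- ('i * z))) / 2.

Definition integrableC (D : set R) (f : R -> C) : Prop :=
  mu.-integrable D (fun t => (Re (f t))%:E) /\
  mu.-integrable D (fun t => (Im (f t))%:E).

Definition integralC (D : set R) (f : R -> C) : C :=
  Rintegral mu D (fun t => Re (f t)) +i*
  Rintegral mu D (fun t => Im (f t)).

(* R[i]^o is R[i] as a normed space over itself, so this is complex
   differentiability. *)
Definition entire (f : C -> C) : Prop :=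
  forall z : C, derivable (f : C^o -> C^o) z 1.

(* F is the entire extension of f, a function that is only meaningful outside
   the set S of its singularities.  When S has empty interior, as below, such an
   F is unique. *)
Definition is_entire_extension (S : set C) (f F : C -> C) : Prop :=
  entire F /\ forall z, ~ S z -> F z = f z.

Definition Gamma_poles : set C := [set s | exists n : nat, s = - n%:R].

Definition Euler_integral (s : C) : C :=
  integralC `]0, +oo[ (fun x : R => powC x%:C (s - 1) * expC (- x%:C)).

(* Analytic continuation of the Euler integral by the functional equation
     Gamma s = Gamma (s + n) / (s (s + 1) ... (s + n - 1)),
   where n is the least natural number such that 0 < Re s + n, so n = 0 if
   0 < Re s.  At a pole the denominator is 0, so Gamma s is 0 by convention;
   hence (Gamma s)^-1 is 0 there, which is the value of the entire function
   1 / Gamma. *)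
Definition Gamma (s : C) : C :=
  let n := Num.truncn (1 - Re s) in
  Euler_integral (s + n%:R) / \prod_(i < n) (s + i%:R).

Definition G_integrand (sigma : R) (z : C) (t : R) : C :=
  let w := sigma +i* t in powC w (2 * z) * expC (w ^+ 2).

Definition G (sigma : R) (z : C) : C := integralC setT (G_integrand sigma z).

End ComplexFunctions.

(* Main.v *)
(* The integrals G sigma z do not depend on sigma: the derivative in sigma of the
   integrand is, up to the factor i, its derivative in t.  Integrating the
   derivative of w ^ (2z + 1) exp(w ^ 2) gives G (z + 1) = - (z + 1/2) G z.

   Reciprocal formula.  Let Re s >= 1.  Scaling the line by e ^ (u / 2) writes
   Euler_integral s * G (1/2 - s) as a double integral, and Fubini turns it into
   the integral of w ^ (1 - 2s) / (1 - w ^ 2) over Re w = x, for any x < 1.  With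
   x = 1 - e and h w = w ^ (1 - 2s) / (1 + w), the integral of
   h w / (w - (1 - 2e)) vanishes (push the line to the right), and adding it turns
   1 / (1 - w) into the Poisson kernel 2e / (e ^ 2 + t ^ 2); as e tends to 0 the
   integral tends to 2 pi (h 1) = pi.

   Cosine formula.  For Re z > 0 let sigma tend to 0: the two half-lines contribute
   e ^ (i pi z) and e ^ (- i pi z) times the same Euler integral.

   Both identities extend to all arguments by the functional equation of G, which
   through the first identity also yields that of Gamma.  The Euler integral is
   handled on the whole line, as the integral of exp(s u - e ^ u). *)

Require Import Defs.
From HB Require Import structures.
From mathcomp Require Import all_boot all_order all_algebra.
From mathcomp Require Import all_classical all_reals all_analysis.
From mathcomp Require Import measurable_realfun.
From mathcomp Require Import complex ring lra.

Import Order.TTheory GRing.Theory Num.Theory.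
Import numFieldNormedType.Exports.

Local Open Scope classical_set_scope.
Local Open Scope ring_scope.
Local Open Scope complex_scope.

Set Implicit Arguments.
Unset Strict Implicit.
Unset Printing Implicit Defensive.

(** No residue theorem is used: the contours are vertical lines, moved by differentiating under the
    integral sign, and the residue at w = 1 appears as the limit of a Poisson kernel. The pole 1 of
    1 / (1 - w) and the auxiliary pole 1 - 2e are mirror images in the line Re w = 1 - e, which is
    why the two fractions add up to a positive real kernel. The auxiliary pole lies to the left of
    the line, so its term can be pushed off to the right. Keeping 1 / (1 + w) inside h leaves one
    pole to treat and gives h 1 = 1 / 2. The condition Re s >= 1 makes |w ^ (1 - 2s)| at most M / Re
    w for Re w >= 1/2; this is the decay that kills the pushed integral. Nearly every integral over
    a line is controlled by a majorant K / (1 + t ^ 2). The delicate case is the cosine formula,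
    where the line tends to the imaginary axis and the bound may not involve a positive lower bound
    of Re w. Since the product of the Euler integral and G is the nonzero constant pi, the Euler
    integral has no zero for Re s > 0; with x / 0 = 0 the reciprocal formula then holds at the poles
    as well. *)

Local Notation Re := (@complex.Re _).
Local Notation Im := (@complex.Im _).
Local Notation normc := (@ComplexField.Normc.normc _).


(** * Complex arithmetic, exponential and principal logarithm *)

Section ComplexBasics.
Context {R : realType}.
Implicit Types (z w : R[i]) (x y : R).

Lemma complex_eq z w : Re z = Re w -> Im z = Im w -> z = w.
Proof. by case: z w => [a b] [c d] /= -> ->. Qed.

Lemma ReD z w : Re (z + w) = Re z + Re w.
Proof. by case: z w => [a b] [c d]. Qed.

Lemma ImD z w : Im (z + w) = Im z + Im w.
Proof. by case: z w => [a b] [c d]. Qed.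

Lemma ReN z : Re (- z) = - Re z.
Proof. by case: z. Qed.

Lemma ImN z : Im (- z) = - Im z.
Proof. by case: z. Qed.

Lemma ReM z w : Re (z * w) = Re z * Re w - Im z * Im w.
Proof. by case: z w => [a b] [c d]. Qed.

Lemma ImM z w : Im (z * w) = Re z * Im w + Im z * Re w.
Proof. by case: z w => [a b] [c d]. Qed.

Lemma Re_nat n : Re (n%:R : R[i]) = n%:R.
Proof. by elim: n => // n IH; rewrite -!natr1 ReD IH. Qed.

Lemma Im_nat n : Im (n%:R : R[i]) = 0.
Proof. by elim: n => // n IH; rewrite -!natr1 ImD IH addr0. Qed.

Lemma ReX2 z : Re (z ^+ 2) = Re z ^+ 2 - Im z ^+ 2.
Proof. by rewrite expr2 ReM -!expr2. Qed.

Lemma ImX2 z : Im (z ^+ 2) = 2 * Re z * Im z.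
Proof. by rewrite expr2 ImM; ring. Qed.

Definition ReImE := (ReD, ImD, ReN, ImN, ReX2, ImX2, ReM, ImM, Re_nat, Im_nat).

Lemma natC n : (n%:R : R)%:C = n%:R :> R[i].
Proof. by rewrite rmorph_nat. Qed.

Lemma realCM x y : (x * y)%:C = x%:C * y%:C.
Proof. exact: rmorphM. Qed.

Lemma realCV x : (x^-1)%:C = (x%:C)^-1.
Proof. exact: fmorphV. Qed.

Lemma half_realC : 2^-1 = (2^-1 : R)%:C :> R[i].
Proof. by rewrite realCV natC. Qed.

Lemma sqr_normc z : normc z ^+ 2 = Re z ^+ 2 + Im z ^+ 2.
Proof. by case: z => a b /=; rewrite sqr_sqrtr ?addr_ge0 ?sqr_ge0. Qed.

Lemma normc_ge0 z : 0 <= normc z.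
Proof. by case: z => a b /=; exact: sqrtr_ge0. Qed.

Lemma normc_ge_Re z : `|Re z| <= normc z.
Proof.
rewrite -(@ler_pXn2r _ 2%N) ?nnegrE ?normc_ge0// sqr_normc real_normK ?num_real//.
by rewrite lerDl sqr_ge0.
Qed.

Lemma normc_ge_Im z : `|Im z| <= normc z.
Proof.
rewrite -(@ler_pXn2r _ 2%N) ?nnegrE ?normc_ge0// sqr_normc real_normK ?num_real//.
by rewrite lerDr sqr_ge0.
Qed.

Lemma normc_le_ReIm z : normc z <= `|Re z| + `|Im z|.
Proof.
rewrite -(@ler_pXn2r _ 2%N) ?nnegrE ?normc_ge0 ?addr_ge0// sqr_normc.
rewrite sqrrD !real_normK ?num_real// addrAC lerDl.
by rewrite mulrn_wge0// mulr_ge0.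
Qed.

Lemma normc_real x : normc (x%:C) = `|x|.
Proof. by rewrite /= expr0n addr0 sqrtr_sqr. Qed.

Lemma normc_eq0 z : (normc z == 0) = (z == 0).
Proof.
apply/eqP/eqP => [|->]; first exact: ComplexField.Normc.eq0_normc.
exact: ComplexField.Normc.normc0.
Qed.

Lemma normr_normc z : `|z| = (normc z)%:C.
Proof. by case: z. Qed.

Lemma Re_gt0_neq0 z : 0 < Re z -> z != 0.
Proof. by apply: contraTneq => ->; rewrite /= ltxx. Qed.

Lemma expCD z w : expC (z + w) = expC z * expC w.
Proof.
by apply: complex_eq; rewrite !ReImE /= !ReImE expRD ?cosD ?sinD; ring.
Qed.

Lemma expC0 : expC (0 : R[i]) = 1.
Proof. by rewrite /expC /= expR0 cos0 sin0 mulr1 mulr0. Qed.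

Lemma expCNM z : expC (- z) * expC z = 1.
Proof. by rewrite -expCD addNr expC0. Qed.

Lemma expC_neq0 z : expC z != 0.
Proof.
by apply/eqP => e; move: (expCNM z); rewrite e mulr0 => /esym/eqP; rewrite oner_eq0.
Qed.

Lemma expCN z : expC (- z) = (expC z)^-1.
Proof. by rewrite -[RHS]mul1r -(expCNM z) mulfK// expC_neq0. Qed.

Lemma normc_expC z : normc (expC z) = expR (Re z).
Proof.
by rewrite /= !exprMn -mulrDr cos2Dsin2 mulr1 sqrtr_sqr ger0_norm// expR_ge0.
Qed.

Lemma normc_expC_le z : normc (expC z) <= expR (normc z).
Proof. by rewrite normc_expC ler_expR (le_trans (ler_norm _)) ?normc_ge_Re. Qed.

Lemma expC_real x : expC x%:C = (expR x)%:C.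
Proof. by apply: complex_eq; rewrite /= ?cos0 ?sin0 ?mulr1 ?mulr0. Qed.

(* A form of the principal logarithm that is differentiable without the case
   distinction of argC; it is only used where 0 < Re w. *)
Definition LogC w : R[i] :=
  (2^-1 * ln (Re w ^+ 2 + Im w ^+ 2)) +i* atan (Im w / Re w).

Lemma Re_LogC w : 0 < Re w -> Re (LogC w) = ln (normc w).
Proof.
move=> w0; have n0 : 0 < normc w by rewrite lt0r normc_ge0 normc_eq0 Re_gt0_neq0.
by rewrite /= -sqr_normc lnXn//; field.
Qed.

Lemma expR_half_ln x : 0 < x -> expR (2^-1 * ln x) = Num.sqrt x.
Proof.
move=> x0; apply/eqP; rewrite -(@eqrXn2 _ 2) ?expR_ge0 ?sqrtr_ge0//.
by rewrite sqr_sqrtr ?ltW// -expRM_natl mulVKf ?pnatr_eq0// lnK ?posrE.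
Qed.

(** The cosine of the arctangent is Re w / |w|. As [acos] inverts the cosine on [0, pi] only, the
    lower half-plane is reduced to the upper one by evenness of the cosine. *)
Lemma argC_atan w : 0 < Re w -> argC w = atan (Im w / Re w).
Proof.
case: w => x y /= x0.
have n0 : 0 < Num.sqrt (x ^+ 2 + y ^+ 2) by rewrite sqrtr_gt0 ltr_pwDl ?exprn_gt0 ?sqr_ge0.
have cE : x / Num.sqrt (x ^+ 2 + y ^+ 2) = cos (atan (y / x)).
  rewrite cos_atan; have -> : x ^+ 2 + y ^+ 2 = x ^+ 2 * (1 + (y / x) ^+ 2).
    by field; rewrite gt_eqF.
  by rewrite sqrtrM ?sqr_ge0// sqrtr_sqr gtr0_norm// invfM mulVKf ?gt_eqF.
have pih : (pi : R) / 2 <= pi by have := pi_ge0 R; lra.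
rewrite /argC /= cE; case: ifPn => y0.
  rewrite cosK// in_itv/=; apply/andP; split.
    by rewrite -[leLHS](@atan0 R) le_atan// divr_ge0// ltW.
  by rewrite (le_trans (ltW (atan_ltpi2 _))).
rewrite -cosN cosK ?opprK// in_itv/= -atanN; apply/andP; split.
  rewrite -[leLHS](@atan0 R) le_atan// -mulNr divr_ge0// ?ltW//.
  by rewrite oppr_gt0 ltNge.
by rewrite (le_trans (ltW (atan_ltpi2 _))).
Qed.

Lemma logCE w : 0 < Re w -> logC w = LogC w.
Proof.
move=> w0; apply: complex_eq; first by rewrite Re_LogC.
by rewrite /= argC_atan.
Qed.

Lemma expC_LogC w : 0 < Re w -> expC (LogC w) = w.
Proof.
case: w => x y /= x0.
have n0 : 0 < x ^+ 2 + y ^+ 2 by rewrite ltr_pwDl ?exprn_gt0 ?sqr_ge0.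
have e : Num.sqrt (x ^+ 2 + y ^+ 2) * cos (atan (y / x)) = x.
  rewrite cos_atan; have -> : x ^+ 2 + y ^+ 2 = x ^+ 2 * (1 + (y / x) ^+ 2).
    by field; rewrite gt_eqF.
  rewrite sqrtrM ?sqr_ge0// sqrtr_sqr gtr0_norm// mulfK// sqrtr_eq0 -ltNge.
  by rewrite ltr_pwDl ?sqr_ge0.
have c0 : cos (atan (y / x)) != 0.
  by apply: contra_eqN e => /eqP ->; rewrite mulr0 lt_eqF.
apply: complex_eq; rewrite /= expR_half_ln//.
have -> : sin (atan (y / x)) = y / x * cos (atan (y / x)).
  by rewrite -{2}[y / x]atanK /tan divfK.
by rewrite mulrCA e divfK ?gt_eqF.
Qed.

Lemma powC_pos x z : 0 < x -> powC x%:C z = expC (z * (ln x)%:C).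
Proof.
move=> x0; rewrite /powC logCE//; congr (expC (_ * _)); apply: complex_eq.
  by rewrite Re_LogC// normc_real gtr0_norm.
by rewrite /= mul0r atan0.
Qed.

End ComplexBasics.

(** * Real differentiation rules in pointwise form *)

Section RealDerivatives.
Context {R : realType}.
Implicit Types (f g : R -> R) (x a b : R).

Lemma is_derive_mul f g x a b :
  is_derive x 1 f a -> is_derive x 1 g b ->
  is_derive x 1 (fun t => f t * g t) (f x * b + a * g x).
Proof.
by move=> fa gb; apply: (is_derive_eq (is_deriveM fa gb)); rewrite (mulrC a).
Qed.

Lemma is_derive_add f g x a b :
  is_derive x 1 f a -> is_derive x 1 g b ->
  is_derive x 1 (fun t => f t + g t) (a + b).
Proof. by move=> fa gb; exact: is_deriveD. Qed.

Lemma is_derive_opp f x a :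
  is_derive x 1 f a -> is_derive x 1 (fun t => - f t) (- a).
Proof. by move=> fa; exact: is_deriveN. Qed.

Lemma is_derive_comp f g x a b :
  is_derive (g x) 1 f a -> is_derive x 1 g b ->
  is_derive x 1 (fun t => f (g t)) (a * b).
Proof.
by move=> fa gb; apply: (is_derive_eq (is_derive1_comp fa gb)); rewrite mulrC.
Qed.

Lemma is_derive_inv f x a : f x != 0 ->
  is_derive x 1 f a -> is_derive x 1 (fun t => (f t)^-1) (- (f x)^-2 * a).
Proof. by move=> f0 fa; exact: is_deriveV. Qed.

Lemma is_derive_continuous f x a : is_derive x 1 f a -> {for x, continuous f}.
Proof.
by move=> [df _]; apply: differentiable_continuous; exact/derivable1_diffP.
Qed.

End RealDerivatives.

(** * Derivatives of complex curves of a real parameter *)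

Section ComplexDerivatives.
Context {R : realType}.
Implicit Types (c e : R -> R[i]) (t : R) (d z w : R[i]).

(** Only curves of a real parameter are differentiated. Holomorphy of an integrand enters through
    the curves [x +i* t] with one coordinate fixed. *)
Definition derC c t d : Prop :=
  is_derive t 1 (fun x => Re (c x)) (Re d) /\
  is_derive t 1 (fun x => Im (c x)) (Im d).

Definition continuousC c : Prop :=
  continuous (fun x => Re (c x)) /\ continuous (fun x => Im (c x)).

Lemma derC_continuousC c (d : R -> R[i]) :
  (forall t, derC c t (d t)) -> continuousC c.
Proof.
by move=> h; split=> t; case: (h t) => h1 h2; exact: is_derive_continuous.
Qed.

Lemma derC_eq c t d d' : derC c t d' -> d' = d -> derC c t d.
Proof. by move=> h <-. Qed.

Lemma derC_ext c e t d : (forall x, c x = e x) -> derC c t d -> derC e t d.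
Proof. by move=> h; rewrite (_ : e = c)//; apply/funext => x; rewrite h. Qed.

Lemma derC_cst z t : derC (fun=> z) t 0.
Proof. by split; exact: is_derive_cst. Qed.

Lemma derC_add c e t d d' :
  derC c t d -> derC e t d' -> derC (fun x => c x + e x) t (d + d').
Proof.
move=> [h1 h2] [h3 h4]; split; rewrite !ReImE.
  by under eq_fun do rewrite ReD; exact: is_derive_add.
by under eq_fun do rewrite ImD; exact: is_derive_add.
Qed.

Lemma derC_opp c t d : derC c t d -> derC (fun x => - c x) t (- d).
Proof.
move=> [h1 h2]; split; rewrite !ReImE.
  by under eq_fun do rewrite ReN; exact: is_derive_opp.
by under eq_fun do rewrite ImN; exact: is_derive_opp.
Qed.

Lemma derC_mul c e t d d' :
  derC c t d -> derC e t d' -> derC (fun x => c x * e x) t (d * e t + c t * d').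
Proof.
move=> [h1 h2] [h3 h4]; split; rewrite !ReImE.
  under eq_fun do rewrite ReM.
  apply: (is_derive_eq (is_derive_add (is_derive_mul h1 h3)
    (is_derive_opp (is_derive_mul h2 h4)))).
  ring.
under eq_fun do rewrite ImM.
apply: (is_derive_eq (is_derive_add (is_derive_mul h1 h4) (is_derive_mul h2 h3))).
ring.
Qed.

Lemma derC_mull z c t d : derC c t d -> derC (fun x => z * c x) t (z * d).
Proof.
by move=> h; apply: derC_eq (derC_mul (derC_cst z t) h) _; rewrite mul0r add0r.
Qed.

Lemma derC_real (f : R -> R) t a : is_derive t 1 f a -> derC (fun x => (f x)%:C) t a%:C.
Proof. by move=> h; split => //; exact: is_derive_cst. Qed.

Lemma derC_realid t : derC (fun x => x%:C) t 1.
Proof. by apply: (@derC_real id); exact: is_derive_id. Qed.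

Lemma derC_expC c t d : derC c t d -> derC (fun x => expC (c x)) t (expC (c t) * d).
Proof.
move=> [h1 h2]; split; rewrite !ReImE /=.
  apply: (is_derive_eq (is_derive_mul (is_derive_comp (is_derive_expR _) h1)
    (is_derive_comp (is_derive_cos _) h2))).
  ring.
apply: (is_derive_eq (is_derive_mul (is_derive_comp (is_derive_expR _) h1)
  (is_derive_comp (is_derive_sin _) h2))).
ring.
Qed.

Lemma ReV z : Re z^-1 = Re z / (Re z ^+ 2 + Im z ^+ 2).
Proof. by case: z. Qed.

Lemma ImV z : Im z^-1 = - (Im z / (Re z ^+ 2 + Im z ^+ 2)).
Proof. by case: z. Qed.

Lemma derC_LogC c t d : 0 < Re (c t) ->
  derC c t d -> derC (fun x => LogC (c x)) t (d / c t).
Proof.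
move=> c0 [h1 h2].
have n0 : 0 < Re (c t) * Re (c t) + Im (c t) * Im (c t).
  by rewrite ltr_pwDl ?mulr_gt0// -expr2 sqr_ge0.
have n1 : Re (c t) * Re (c t) + Im (c t) * Im (c t) != 0 by rewrite gt_eqF.
have c1 : Re (c t) != 0 by rewrite gt_eqF.
split; rewrite !ReImE ReV ImV /=.
  under eq_fun do rewrite !expr2.
  have h := is_derive_add (is_derive_mul h1 h1) (is_derive_mul h2 h2).
  have l := @is_derive_comp R (@ln R) _ t _ _ (is_derive1_ln n0) h.
  apply: (is_derive_eq (is_derive_mul (is_derive_cst (2^-1 : R) t 1) l)).
  by rewrite /cst /=; field; rewrite ?expr2 n1.
have h := is_derive_mul h2 (@is_derive_inv _ _ _ _ c1 h1).
apply: (is_derive_eq (@is_derive_comp R (@atan R) _ t _ _ (is_derive1_atan _) h)).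
by rewrite /=; field; rewrite ?expr2 c1 n1.
Qed.

End ComplexDerivatives.

(** * Real integrals over the line and the Cauchy density *)

Section RealIntegrals.
Context {R : realType}.
Local Notation mu := (@lebesgue_measure R).
Implicit Types (f g F : R -> R) (t : R).

Lemma one_sqr_gt0 t : 0 < 1 + t ^+ 2.
Proof. by rewrite ltr_pwDl ?sqr_ge0. Qed.

Lemma integral_cauchy_density : (\int[mu]_t ((1 + t ^+ 2)^-1)%:E = pi%:E)%E.
Proof.
have -> : (\int[mu]_t ((1 + t ^+ 2)^-1)%:E = \int[mu]_t ((oneDsqr t)^-1)%:E)%E by [].
rewrite ge0_symfun_integralT.
- rewrite -set_itvcy integral0y_oneDsqr -EFinM; congr EFin; by field.
- by move=> t; rewrite invr_ge0 ltW// one_sqr_gt0.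
- exact: continuous_oneDsqrV.
- by move=> t; rewrite /= /oneDsqr sqrrN.
Qed.

Lemma integrable_cauchy_density (K : R) :
  mu.-integrable setT (EFin \o (fun t => K / (1 + t ^+ 2))).
Proof.
have h : mu.-integrable setT (EFin \o (fun t => (1 + t ^+ 2)^-1)).
  apply/integrableP; split.
    by apply/measurable_EFinP; apply: continuous_measurable_fun; exact: continuous_oneDsqrV.
  under eq_integral => t _ do rewrite /= ger0_norm ?invr_ge0 ?(ltW (one_sqr_gt0 _))//.
  by rewrite integral_cauchy_density ltry.
by have := integrableZl measurableT K h; apply: eq_integrable.
Qed.

Lemma Rintegral_cauchy_density : Rintegral mu setT (fun t => (1 + t ^+ 2)^-1) = pi.
Proof. by rewrite /Rintegral integral_cauchy_density. Qed.

Lemma integrable_le_cauchy f K : measurable_fun setT f ->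
  (forall t, `|f t| <= K / (1 + t ^+ 2)) -> mu.-integrable setT (EFin \o f).
Proof.
move=> mf fK; apply: le_integrable (integrable_cauchy_density K) => //.
  exact/measurable_EFinP.
by move=> t _ /=; rewrite lee_fin (le_trans (fK t))// ler_norm.
Qed.

Lemma Rintegral_dominated_cvg (f_ : nat -> R -> R) f g :
  (forall n, measurable_fun setT (f_ n)) ->
  (forall t, f_ n t @[n --> \oo] --> f t) ->
  mu.-integrable setT (EFin \o g) ->
  (forall n t, `|f_ n t| <= g t) ->
  Rintegral mu setT (f_ n) @[n --> \oo] --> Rintegral mu setT f.
Proof.
move=> mf_ cf ig fg.
have mf : measurable_fun setT f.
  by apply: (measurable_fun_cvg mf_) => // t _; exact: cf.
have [||||if_ _ h] := @dominated_convergence _ _ R mu setT measurableT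
    (fun n => EFin \o f_ n) (EFin \o f) (EFin \o g) _ _ _ ig _.
- by move=> n /=; apply/measurable_EFinP; exact: mf_.
- exact/measurable_EFinP.
- by apply/aeW => t _; apply/fine_cvgP; split; [exact: nearW|exact: cf].
- by apply/aeW => t n _; rewrite /= lee_fin.
apply: fine_cvg; rewrite fineK; first exact: h.
exact: integrable_fin_num.
Qed.

Lemma Rintegral_itv_cvg f : mu.-integrable setT (EFin \o f) ->
  Rintegral mu `[- n%:R, n%:R] f @[n --> \oo] --> Rintegral mu setT f.
Proof.
move=> intf; have /measurable_EFinP mf := measurable_int mu intf.
under eq_cvg do rewrite Rintegral_mkcond.
apply: (@Rintegral_dominated_cvg _ f (fun t => `|f t|)).
- move=> n; apply: (proj1 (@measurable_restrictT _ _ _ _ `[(- n%:R : R), n%:R] f _)) => //.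
  exact: measurable_funTS.
- move=> t; apply: cvg_near_cst.
  near=> n; rewrite patchE mem_set//= in_itv/= -ler_norml.
  by near: n; exact: nbhs_infty_ger.
- exact: integrable_norm.
- by move=> n t; rewrite patchE; case: ifPn => // _; rewrite normr0.
Unshelve. all: by end_near. Qed.

Lemma Rintegral_FTC_line F f l1 l2 :
  (forall t, is_derive t 1 F (f t)) -> continuous f ->
  mu.-integrable setT (EFin \o f) ->
  F (- n%:R) @[n --> \oo] --> l1 -> F n%:R @[n --> \oo] --> l2 ->
  Rintegral mu setT f = l2 - l1.
Proof.
move=> dF cf intf Fl1 Fl2.
have h : F n%:R - F (- n%:R) @[n --> \oo] --> l2 - l1 by exact: cvgB.
apply: (cvg_unique _ (Rintegral_itv_cvg intf)) => //.
apply: cvg_trans h; apply: near_eq_cvg; near=> n.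
have n0 : - n%:R < n%:R :> R.
  by rewrite gtrN// ltr0n; near: n; exact: nbhs_infty_gt.
rewrite /Rintegral (@continuous_FTC2 _ f F)//.
- exact: continuous_subspaceT.
- have cF : continuous F by move=> t; exact: is_derive_continuous.
  split; first by move=> t _; case: (dF t).
  + by apply: cvg_at_right_filter; exact: cF.
  + by apply: cvg_at_left_filter; exact: cF.
- by move=> t _; rewrite derive1E; case: (dF t).
Unshelve. all: by end_near. Qed.

End RealIntegrals.

(** * Complex limits and complex integrals over the line *)

Section ComplexIntegrals.
Context {R : realType}.
Local Notation mu := (@lebesgue_measure R).
Implicit Types (f g F : R -> R[i]) (t : R) (z : R[i]) (u v : nat -> R[i]).

Definition cvgC u z : Prop :=
  (Re (u n) @[n --> \oo] --> Re z) /\ (Im (u n) @[n --> \oo] --> Im z).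

Lemma cvgC_unique u z w : cvgC u z -> cvgC u w -> z = w.
Proof.
move=> [h1 h2] [h3 h4]; apply: complex_eq.
- exact: (cvg_unique _ h1 h3).
- exact: (cvg_unique _ h2 h4).
Qed.

Lemma cvgC_cst z : cvgC (fun=> z) z.
Proof. by split; exact: cvg_cst. Qed.

Lemma cvgC_ext u v z : (forall n, u n = v n) -> cvgC u z -> cvgC v z.
Proof. by move=> h; rewrite (_ : v = u)//; apply/funext => n; rewrite h. Qed.

Lemma cvgC_add u v z w : cvgC u z -> cvgC v w -> cvgC (fun n => u n + v n) (z + w).
Proof.
move=> [h1 h2] [h3 h4]; split; rewrite !ReImE.
  by under eq_cvg do rewrite ReD; exact: cvgD.
by under eq_cvg do rewrite ImD; exact: cvgD.
Qed.

Lemma cvgC_mul u v z w : cvgC u z -> cvgC v w -> cvgC (fun n => u n * v n) (z * w).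
Proof.
move=> [h1 h2] [h3 h4]; split; rewrite !ReImE.
  by under eq_cvg do rewrite ReM; apply: cvgB; exact: cvgM.
by under eq_cvg do rewrite ImM; apply: cvgD; exact: cvgM.
Qed.

Lemma cvgC_real (x : nat -> R) (l : R) : x n @[n --> \oo] --> l ->
  cvgC (fun n => (x n)%:C) l%:C.
Proof. by move=> h; split => //=; exact: cvg_cst. Qed.

Lemma cvg_seq_comp (x : nat -> R) (l : R) (h : R -> R) : {for l, continuous h} ->
  x n @[n --> \oo] --> l -> h (x n) @[n --> \oo] --> h l.
Proof. by move=> hc xl; apply: (continuous_cvg _ hc). Qed.

Lemma cvgC_expC u z : cvgC u z -> cvgC (fun n => expC (u n)) (expC z).
Proof.
move=> [h1 h2].
have hE : expR (Re (u n)) @[n --> \oo] --> expR (Re z).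
  by apply: cvg_seq_comp h1; exact: continuous_expR.
split => /=; apply: cvgM => //; apply: cvg_seq_comp h2.
- exact: continuous_cos.
- exact: continuous_sin.
Qed.

Lemma cvgC_LogC u z : 0 < Re z -> cvgC u z -> cvgC (fun n => LogC (u n)) (LogC z).
Proof.
move=> z0 [h1 h2]; split => /=.
  apply: cvgM; first exact: cvg_cst.
  apply: (cvg_seq_comp (x := fun n => Re (u n) ^+ 2 + Im (u n) ^+ 2)).
    by apply: continuous_ln; rewrite ltr_pwDl ?exprn_gt0 ?sqr_ge0.
  by rewrite !expr2; under eq_cvg do rewrite !expr2; apply: cvgD; exact: cvgM.
apply: (cvg_seq_comp (x := fun n => Im (u n) / Re (u n))).
  exact: continuous_atan.
by apply: cvgM => //; apply: cvgV => //; rewrite gt_eqF.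
Qed.

Lemma cvgC_norm0 u (x : nat -> R) : (forall n, normc (u n) <= x n) ->
  x n @[n --> \oo] --> (0 : R) -> cvgC u 0.
Proof.
move=> ux x0.
have x0N : - x n @[n --> \oo] --> (0 : R) by rewrite -oppr0; exact: cvgN.
split => /=; apply: (@squeeze_cvgr _ _ _ _ (fun n => - x n) x) => //;
  apply: nearW => n; rewrite -ler_norml (le_trans _ (ux n))//.
- exact: normc_ge_Re.
- exact: normc_ge_Im.
Qed.

(** The common majorant: it is integrable with a known integral, and it tends to 0 at both ends, so
    the same bound on an antiderivative kills its boundary terms. *)
Definition cauchy_bounded f (K : R) : Prop :=
  forall t, normc (f t) <= K / (1 + t ^+ 2).

Lemma integrableC_bounded f K : continuousC f -> cauchy_bounded f K ->
  integrableC setT f.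
Proof.
move=> [c1 c2] fK; split; apply: (@integrable_le_cauchy _ _ K).
- exact: continuous_measurable_fun.
- by move=> t; rewrite (le_trans (normc_ge_Re _)).
- exact: continuous_measurable_fun.
- by move=> t; rewrite (le_trans (normc_ge_Im _)).
Qed.

Lemma eq_integralC (D : set R) f g : (forall t, D t -> f t = g t) ->
  integralC D f = integralC D g.
Proof.
move=> h; apply: complex_eq => /=; apply: eq_Rintegral => t;
  by rewrite inE => Dt; rewrite h.
Qed.

Lemma eq_integrableC f g : (forall t, f t = g t) -> integrableC setT f -> integrableC setT g.
Proof. by move=> h; rewrite (_ : g = f)//; apply/funext => t; rewrite h. Qed.

Lemma integrableCD f g : integrableC setT f -> integrableC setT g ->
  integrableC setT (fun t => f t + g t).
Proof.
move=> [h1 h2] [h3 h4]; split.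
  by under eq_fun do rewrite ReD EFinD; exact: integrableD.
by under eq_fun do rewrite ImD EFinD; exact: integrableD.
Qed.

Lemma integralCD f g : integrableC setT f -> integrableC setT g ->
  integralC setT (fun t => f t + g t) = integralC setT f + integralC setT g.
Proof.
move=> [h1 h2] [h3 h4]; apply: complex_eq; rewrite ?ReD ?ImD /=.
  by under eq_Rintegral do rewrite ReD; rewrite RintegralD.
by under eq_Rintegral do rewrite ImD; rewrite RintegralD.
Qed.

Lemma integrable_realZl (a : R) (h : R -> R) : mu.-integrable setT (EFin \o h) ->
  mu.-integrable setT (EFin \o (fun t => a * h t)).
Proof. by move=> ih; have := integrableZl measurableT a ih; apply: eq_integrable. Qed.

Lemma integrableCZ z f : integrableC setT f -> integrableC setT (fun t => z * f t).
Proof.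
move=> [h1 h2]; split.
  under eq_fun do rewrite ReM EFinB.
  by apply: integrableB => //; exact: integrable_realZl.
under eq_fun do rewrite ImM EFinD.
by apply: integrableD => //; exact: integrable_realZl.
Qed.

Lemma integralCZ z f : integrableC setT f ->
  integralC setT (fun t => z * f t) = z * integralC setT f.
Proof.
move=> [h1 h2]; apply: complex_eq; rewrite ?ReM ?ImM /=.
  under eq_Rintegral do rewrite ReM.
  by rewrite RintegralB ?RintegralZl//; exact: integrable_realZl.
under eq_Rintegral do rewrite ImM.
by rewrite RintegralD ?RintegralZl//; exact: integrable_realZl.
Qed.

(** The factor 2 is the price of estimating the real and imaginary parts separately. *)
Lemma normc_integralC_le f K : integrableC setT f -> cauchy_bounded f K ->
  normc (integralC setT f) <= 2 * pi * K.
Proof.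
move=> [h1 h2] fK.
have b (h : R -> R) : mu.-integrable setT (EFin \o h) ->
    (forall t, `|h t| <= normc (f t)) -> `|Rintegral mu setT h| <= pi * K.
  move=> ih hf; rewrite (le_trans (le_normr_Rintegral measurableT ih))//.
  rewrite -Rintegral_cauchy_density mulrC -RintegralZl//; last first.
    by have := @integrable_cauchy_density R 1; apply: eq_integrable => // t _ /=; rewrite mul1r.
  apply: le_Rintegral => //.
  - exact: integrable_norm.
  - exact: integrable_cauchy_density.
  - by move=> t _; rewrite (le_trans (hf t)).
rewrite (le_trans (normc_le_ReIm _))//=.
have -> : 2 * pi * K = pi * K + pi * K by ring.
apply: lerD; apply: b => // t; [exact: normc_ge_Re|exact: normc_ge_Im].
Qed.

Lemma integralC_dominated_cvg (f_ : nat -> R -> R[i]) f K :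
  (forall n, continuousC (f_ n)) -> (forall t, cvgC (fun n => f_ n t) (f t)) ->
  (forall n, cauchy_bounded (f_ n) K) ->
  cvgC (fun n => integralC setT (f_ n)) (integralC setT f).
Proof.
move=> cf ff fK; split => /=.
  apply: (Rintegral_dominated_cvg _ _ (integrable_cauchy_density K)).
  - by move=> n; apply: continuous_measurable_fun; case: (cf n).
  - by move=> t; case: (ff t).
  - by move=> n t; rewrite (le_trans (normc_ge_Re _))//; exact: fK.
apply: (Rintegral_dominated_cvg _ _ (integrable_cauchy_density K)).
- by move=> n; apply: continuous_measurable_fun; case: (cf n).
- by move=> t; case: (ff t).
- by move=> n t; rewrite (le_trans (normc_ge_Im _))//; exact: fK.
Qed.

Lemma integralC_FTC F f z w :
  (forall t, derC F t (f t)) -> continuousC f -> integrableC setT f ->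
  cvgC (fun n => F (- n%:R)) z -> cvgC (fun n => F n%:R) w ->
  integralC setT f = w - z.
Proof.
move=> dF [c1 c2] [i1 i2] [z1 z2] [w1 w2].
apply: complex_eq; rewrite !ReImE /=.
- by apply: (Rintegral_FTC_line (F := fun t => Re (F t))) => // t; case: (dF t).
- by apply: (Rintegral_FTC_line (F := fun t => Im (F t))) => // t; case: (dF t).
Qed.

Lemma cvg_cauchy_density (K : R) : K / (1 + n%:R ^+ 2) @[n --> \oo] --> (0 : R).
Proof.
rewrite -(mulr0 K); apply: cvgM; first exact: cvg_cst.
apply: (@squeeze_cvgr _ _ _ _ (fun=> 0) (fun n => n.+1%:R^-1)).
- near=> n; rewrite invr_ge0 (ltW (one_sqr_gt0 _))/= lef_pV2 ?posrE ?one_sqr_gt0//.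
  rewrite -natrX -natr1 [in leLHS]addrC lerD2l ler_nat.
  by case: (n) => // m; rewrite expnS expn1 leq_pmulr.
- exact: cvg_cst.
- exact: cvg_harmonic.
Unshelve. all: by end_near. Qed.

(** Source of the contour shift and of both functional equations: the boundary values of [F] vanish
    at infinity. *)
Lemma integralC_derivative_eq0 F f K :
  (forall t, derC F t (f t)) -> continuousC f -> integrableC setT f ->
  cauchy_bounded F K -> integralC setT f = 0.
Proof.
move=> dF cf intf FK; rewrite (integralC_FTC dF cf intf (z := 0) (w := 0)) ?subrr//.
- apply: cvgC_norm0 (cvg_cauchy_density K) => n.
  by have := FK (- n%:R); rewrite sqrrN.
- exact: cvgC_norm0 (cvg_cauchy_density K).
Qed.

End ComplexIntegrals.

(** * Increasing substitutions from the whole line onto an interval *)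

Section Substitution.
Context {R : realType}.
Local Notation mu := (@lebesgue_measure R).
Variables (D : set R) (phi dphi : R -> R).
Hypotheses (iD : is_interval D) (phiD : forall u, D (phi u))
  (Dphi : forall x, D x -> exists u, phi u = x)
  (dphiE : forall u : R, is_derive u 1 phi (dphi u))
  (cdphi : continuous dphi) (dphi_gt0 : forall u, 0 < dphi u).

Let phi_incr : {homo phi : x y / x < y}.
Proof.
move=> x y xy.
have [c _ e] := @MVT _ phi dphi _ _ xy (fun t _ => dphiE t)
  (continuous_subspaceT (fun t => is_derive_continuous (dphiE t))).
by rewrite -subr_gt0 e mulr_gt0// subr_gt0.
Qed.

Let phi_ndecr : {homo phi : x y / x <= y}.
Proof. by move=> x y; rewrite le_eqVlt => /predU1P[->//|/phi_incr/ltW]. Qed.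

Let cphi : continuous phi.
Proof. by move=> t; exact: is_derive_continuous. Qed.

Let phi1 : derive1 phi = dphi.
Proof. by apply/funext => t; rewrite derive1E; case: (dphiE t). Qed.

Let phi_itv (n : nat) := `[phi (- n%:R), phi n%:R]%classic.

Let phi_itvD n : phi_itv n `<=` D.
Proof.
move=> x; rewrite /phi_itv/= in_itv/= => /andP[x1 x2].
by apply: (iD (phiD (- n%:R)) (phiD n%:R)); rewrite x1 x2.
Qed.

Let bigcup_phi_itv : \bigcup_n phi_itv n = D.
Proof.
apply/seteqP; split=> [x [n _]|x Dx]; first exact: phi_itvD.
have [u <-] := Dphi Dx.
have [n un] : exists n : nat, `|u| <= n%:R.
  by exists (Num.truncn `|u|).+1; rewrite ltW// truncnS_gt.
move: un; rewrite ler_norml => /andP[u1 u2].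
by exists n => //; rewrite /phi_itv/= in_itv/= !phi_ndecr.
Qed.

Let bigcup_nat_itv : \bigcup_n `[- (n%:R : R), n%:R]%classic = setT.
Proof.
apply/seteqP; split=> // u _.
exists (Num.truncn `|u|).+1 => //=; rewrite in_itv/= -ler_norml.
by rewrite ltW// truncnS_gt.
Qed.

(** Substitution on the compact intervals [-n, n], whose images exhaust [D]; monotone convergence
    passes to the limit on both sides. *)
Lemma ge0_integral_substitution_line (g : R -> R) :
  (forall x, D x -> {for x, continuous g}) -> (forall x, 0 <= g x) ->
  (\int[mu]_(x in D) (g x)%:E = \int[mu]_u (g (phi u) * dphi u)%:E)%E.
Proof.
move=> cg g0.
have cgw n : {within phi_itv n, continuous g}.
  apply: continuous_in_subspaceT => x; rewrite inE => /phi_itvD; exact: cg.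
have ch : continuous (fun u => g (phi u) * dphi u).
  move=> u; apply: cvgM; last exact: cdphi.
  by apply: continuous_comp; [exact: cphi|exact: cg].
have h1 : (\int[mu]_(x in phi_itv n) (g x)%:E)%E @[n --> \oo] -->
    (\int[mu]_(x in D) (g x)%:E)%E.
  rewrite -bigcup_phi_itv; apply: ge0_nondecreasing_set_cvg_integral => //.
  - apply/nondecreasing_seqP => n; rewrite subsetEset => x; rewrite /phi_itv/= !in_itv/=.
    move=> /andP[x1 x2]; rewrite (le_trans _ x1) ?(le_trans x2)//;
      by apply: phi_ndecr; rewrite ?lerN2 ler_nat.
  - by move=> n; exact: measurable_itv.
  - by move=> n; apply/measurable_EFinP; apply: subspace_continuous_measurable_fun; [exact: measurable_itv|exact: cgw].
  - by move=> n x _; rewrite lee_fin.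
have h2 : (\int[mu]_(u in `[(- n%:R)%R, n%:R]) (g (phi u) * dphi u)%:E)%E @[n --> \oo] -->
    (\int[mu]_u (g (phi u) * dphi u)%:E)%E.
  rewrite -bigcup_nat_itv; apply: ge0_nondecreasing_set_cvg_integral => //.
  - apply/nondecreasing_seqP => n; rewrite subsetEset => x; rewrite /phi_itv/= !in_itv/=.
    move=> /andP[x1 x2]; rewrite (le_trans _ x1) ?(le_trans x2)//;
      by rewrite ?lerN2 ler_nat.
  - move=> n; apply/measurable_EFinP; apply: measurable_funTS.
    exact: continuous_measurable_fun.
  - by move=> n x _; rewrite lee_fin mulr_ge0// ltW.
apply: (cvg_unique _ h1); rewrite //=.
apply: cvg_trans h2; apply: near_eq_cvg; apply: nearW => n.
rewrite (@integration_by_substitution_increasing _ phi g) ?phi1//.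
- by rewrite (le_trans _ (ler0n _ n))// oppr_le0.
- by move=> x y _ _; exact: phi_incr.
- by apply/cvg_ex; eexists; apply: cvg_at_right_filter; exact: cdphi.
- by apply/cvg_ex; eexists; apply: cvg_at_left_filter; exact: cdphi.
- split; first by move=> x _; case: (dphiE x).
  + by apply: cvg_at_right_filter; exact: cphi.
  + by apply: cvg_at_left_filter; exact: cphi.
- exact: cgw.
Qed.

(** As [dphi] is positive, taking positive and negative parts commutes with multiplying by it, so
    the nonnegative case applies to each part. *)
Lemma integral_substitution_line (f : R -> R) :
  (forall x, D x -> {for x, continuous f}) ->
  (\int[mu]_(x in D) (f x)%:E = \int[mu]_u (f (phi u) * dphi u)%:E)%E.
Proof.
move=> cf; rewrite integralE [RHS]integralE.
rewrite -![fun x => (_ x)%:E]/(EFin \o _) !funerpos !funerneg.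
congr (_ - _)%E.
  rewrite (@ge0_integral_substitution_line f^\+).
  - by apply: eq_integral => u _; rewrite /= /funrpos maxr_pMl ?mul0r// ltW.
  - by move=> x Dx; apply: continuous_max; [exact: cf|exact: cst_continuous].
  - by move=> x; exact: funrpos_ge0.
rewrite (@ge0_integral_substitution_line f^\-).
- by apply: eq_integral => u _; rewrite /= /funrneg maxr_pMl ?mul0r ?mulNr// ltW.
- move=> x Dx; apply: continuous_max; last exact: cst_continuous.
  by apply: cvgN; exact: cf.
- by move=> x; exact: funrneg_ge0.
Qed.

Lemma integralC_substitution_line (f : R -> R[i]) :
  (forall x, D x -> {for x, continuous (fun y => Re (f y))} /\
                    {for x, continuous (fun y => Im (f y))}) ->
  integralC D f = integralC setT (fun u => f (phi u) * (dphi u)%:C).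
Proof.
move=> cf; apply: complex_eq => /=; rewrite /Rintegral.
  rewrite integral_substitution_line; last by move=> x /cf[].
  by congr fine; apply: eq_integral => u _; rewrite ReM /= mulr0 subr0.
rewrite integral_substitution_line; last by move=> x /cf[].
by congr fine; apply: eq_integral => u _; rewrite ImM /= mulr0 add0r.
Qed.

End Substitution.

(** * Scaling, exponential substitution, folding the line onto a half-line *)

Section LineIntegrals.
Context {R : realType}.
Local Notation mu := (@lebesgue_measure R).
Implicit Types (f g : R -> R[i]) (t : R).

Lemma is_derive_scale (c x : R) : is_derive x 1 (fun t => c * t) c.
Proof.
have h : is_derive x 1 (fun t : R => c * t) (c * 1 + 0 * x).
  by apply: (is_derive_mul (is_derive_cst c x 1)); exact: is_derive_id.
by apply: is_derive_eq h _; rewrite mulr1 mul0r addr0.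
Qed.

Lemma is_derive_expR_scale (c x : R) :
  is_derive x 1 (fun t => expR (c * t)) (c * expR (c * x)).
Proof.
have := @is_derive_comp R expR _ x _ _ (is_derive_expR _) (is_derive_scale c x).
by rewrite mulrC.
Qed.

Lemma integralC_scale (c : R) f : 0 < c -> continuousC f ->
  integralC setT f = integralC setT (fun t => f (c * t) * c%:C).
Proof.
move=> c0 [c1 c2].
apply: (@integralC_substitution_line _ setT (fun t => c * t) (fun=> c)) => //.
- by move=> x _; exists (x / c); rewrite mulrC divfK ?gt_eqF.
- by move=> x; exact: is_derive_scale.
- by move=> x; exact: cvg_cst.
- by move=> x _; split; [exact: c1|exact: c2].
Qed.

(** Used with c = 1 for the Euler integral and with c = 1/2 in the cosine formula, where t ^ 2 has
    to become e ^ u. *)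
Lemma integralC_expR (c : R) f : 0 < c ->
  (forall x, 0 < x -> {for x, continuous (fun y => Re (f y))} /\
                      {for x, continuous (fun y => Im (f y))}) ->
  integralC `]0, +oo[ f =
  integralC setT (fun u => f (expR (c * u)) * (c * expR (c * u))%:C).
Proof.
move=> c0 cf.
apply: (@integralC_substitution_line _ _ (fun u => expR (c * u))
  (fun u => c * expR (c * u))).
- exact: interval_is_interval.
- by move=> u /=; rewrite in_itv/= expR_gt0.
- move=> x /=; rewrite in_itv/= andbT => x0; exists (ln x / c).
  by rewrite mulrC divfK ?gt_eqF// lnK ?posrE.
- by move=> u; exact: is_derive_expR_scale.
- move=> u; have h := is_derive_mul (is_derive_cst c u 1) (is_derive_expR_scale c u).
  exact: is_derive_continuous h.
- by move=> u; rewrite mulr_gt0// expR_gt0.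
- by move=> x /=; rewrite in_itv/= andbT; exact: cf.
Qed.

Lemma Rintegral_halves (h : R -> R) (K : R) : continuous h ->
  (forall t, `|h t| <= K / (1 + t ^+ 2)) ->
  Rintegral mu setT h = Rintegral mu `]0, +oo[ (fun t => h t + h (- t)).
Proof.
move=> ch hK.
have chN : continuous (fun t => h (- t)).
  by move=> t; apply: continuous_comp; [exact: opp_continuous|exact: ch].
have ih : mu.-integrable setT (EFin \o h).
  by apply: integrable_le_cauchy hK; exact: continuous_measurable_fun.
have ihN : mu.-integrable setT (EFin \o (fun t => h (- t))).
  apply: (@integrable_le_cauchy _ _ K); first exact: continuous_measurable_fun.
  by move=> t; rewrite (le_trans (hK _))// sqrrN.
have ihD (g : R -> R) : mu.-integrable setT (EFin \o g) ->
    mu.-integrable `]0, +oo[ (EFin \o g).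
  by apply: integrableS.
(* The reflection t -> - t is available for nonnegative functions, hence the split into positive and
   negative parts. *)
have neg : (\int[mu]_(t in `[0%R, +oo[) (h (- t))%:E = \int[mu]_(t in `]-oo, 0%R]) (h t)%:E)%E.
  rewrite integralE [RHS]integralE; congr (_ - _)%E.
    rewrite ge0_integration_by_substitution0.
    - by apply: eq_integral => t _; rewrite !funeposE/= opprK.
    - by apply: measurable_funepos; apply/measurable_EFinP; exact: continuous_measurable_fun.
    - by move=> t; exact: funepos_ge0.
  rewrite ge0_integration_by_substitution0.
  - by apply: eq_integral => t _; rewrite !funenegE/= opprK.
  - by apply: measurable_funeneg; apply/measurable_EFinP; exact: continuous_measurable_fun.
  - by move=> t; exact: funeneg_ge0.
rewrite RintegralD//; [|exact: ihD|exact: ihD].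
(* The point 0 is added so that the reflected half-line is exactly the complement of the open
   positive one. *)
rewrite (Rintegral_itv_obnd_cbnd (ihD _ ihN)).
rewrite [X in _ = _ + X]/Rintegral neg -/(Rintegral _ _ _) addrC.
rewrite -Rintegral_setU//.
- by congr Rintegral; rewrite -setCitvr setvU.
- by rewrite -setCitvr setvU.
- by rewrite -setCitvr disj_set2E setICl.
Qed.

Lemma integralC_halves f K : continuousC f -> cauchy_bounded f K ->
  integralC setT f = integralC `]0, +oo[ (fun t => f t + f (- t)).
Proof.
move=> [c1 c2] fK; apply: complex_eq => /=.
  under [RHS]eq_Rintegral do rewrite ReD.
  apply: (@Rintegral_halves (fun t => Re (f t)) K) => // t.
  by rewrite (le_trans (normc_ge_Re _)).
under [RHS]eq_Rintegral do rewrite ImD.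
apply: (@Rintegral_halves (fun t => Im (f t)) K) => // t.
by rewrite (le_trans (normc_ge_Im _)).
Qed.

End LineIntegrals.

(** * Moving a vertical line of integration *)

Section ContourShift.
Context {R : realType}.
Local Notation mu := (@lebesgue_measure R).

(** Under the integral sign the derivative in x is the integral of [h'], which is 0, and the mean
    value theorem gives constancy. The bounds are asked on compact ranges only, since the constant
    may blow up at [x0]. *)
Lemma Rintegral_line_cst (h h' : R -> R -> R) (x0 : R) :
  (forall x t, x0 < x -> is_derive x 1 (h ^~ t) (h' x t)) ->
  (forall x, x0 < x -> measurable_fun setT (h x)) ->
  (forall x, x0 < x -> Rintegral mu setT (h' x) = 0) ->
  (forall a b, x0 < a -> exists K, forall x t, a <= x <= b ->
    `|h x t| <= K / (1 + t ^+ 2) /\ `|h' x t| <= K / (1 + t ^+ 2)) ->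
  forall a b, x0 < a -> x0 < b -> Rintegral mu setT (h a) = Rintegral mu setT (h b).
Proof.
move=> dh mh h'0 hK.
have d0 x : x0 < x -> is_derive x 1 (fun y => Rintegral mu setT (h y)) 0.
  (* A window around x that stays at a positive distance from [x0], where the uniform bound
     applies. *)
  move=> x0x; pose u := (x0 + x) / 2; pose v := x + 1.
  have u0 : x0 < u by rewrite /u; lra.
  have [K hKx] := hK u v u0.
  have inI y : `]u, v[%classic y -> u <= y <= v.
    by rewrite /= in_itv/= => /andP[/ltW -> /ltW ->].
  have d1E y t : x0 < y -> partial1of2 h y t = h' y t.
    by move=> y0; rewrite /partial1of2 derive1E; case: (dh y t y0).
  have I0 y : `]u, v[%classic y -> x0 < y.
    by rewrite /= in_itv/= => /andP[uy _]; exact: lt_trans uy.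
  have Ix : `]u, v[%classic x by rewrite /= in_itv/= /u /v; apply/andP; split; lra.
  have K0 : 0 <= K.
    have [] := hKx x 0 (inI x Ix) => + _; rewrite expr0n addr0 divr1.
    exact: le_trans.
  have C1 y : `]u, v[%classic y -> mu.-integrable setT (EFin \o h y).
    move=> Iy; apply: (@integrable_le_cauchy _ _ K); first by apply: mh; exact: I0.
    by move=> t; case: (hKx y t (inI _ Iy)).
  have C2 y t : `]u, v[%classic y -> setT t -> derivable (h ^~ t) y 1.
    by move=> Iy _; case: (dh y t (I0 _ Iy)).
  have C3 t : 0 <= K / (1 + t ^+ 2) by rewrite divr_ge0// ltW// one_sqr_gt0.
  have C4 y t : `]u, v[%classic y -> setT t -> `|partial1of2 h y t| <= K / (1 + t ^+ 2).
    by move=> Iy _; rewrite d1E ?(I0 _ Iy)//; case: (hKx y t (inI _ Iy)).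
  apply: DeriveDef.
    exact: (derivable_under_integral measurableT Ix C1 C2 C3 (integrable_cauchy_density K) C4).
  rewrite -derive1E (differentiation_under_integral measurableT Ix C1 C2 C3
    (integrable_cauchy_density K) C4).
  by rewrite -(h'0 x x0x); apply: eq_Rintegral => t _; exact: d1E.
move=> a b; wlog ab : a b / a <= b.
  by move=> H a0 b0; have [/H->//|/ltW/H->//] := leP a b.
move=> a0 b0.
have [||c _] := @MVT_segment _ (fun y => Rintegral mu setT (h y)) (fun=> 0) _ _ ab.
- move=> x; rewrite in_itv/= => /andP[ax _]; apply: d0; exact: lt_trans ax.
- apply: continuous_in_subspaceT => x; rewrite inE/= in_itv/= => /andP[ax _].
  by apply: is_derive_continuous; apply: d0; exact: lt_le_trans ax.
- by rewrite mul0r => /eqP; rewrite subr_eq0 => /eqP.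
Qed.

(** Stands in for Cauchy's theorem. The first two hypotheses are the Cauchy-Riemann equations; the
    bound on [f] removes the ends of the lines, the bound on [f'] justifies differentiating under
    the integral. *)
Lemma contour_shift (f f' : R -> R -> R[i]) (x0 : R) :
  (forall x t, x0 < x -> derC (f ^~ t) x (f' x t)) ->
  (forall x t, x0 < x -> derC (f x) t ('i * f' x t)) ->
  (forall x, x0 < x -> continuousC (f' x)) ->
  (forall a b, x0 < a -> exists K, forall x, a <= x <= b ->
    cauchy_bounded (f x) K /\ cauchy_bounded (f' x) K) ->
  forall a b, x0 < a -> x0 < b -> integralC setT (f a) = integralC setT (f b).
Proof.
move=> dx dt cf' fK a b a0 b0.
have f'0 x : x0 < x -> integralC setT (f' x) = 0.
  move=> x0x; have [K /(_ x) []] := fK x x x0x; first by rewrite lexx.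
  move=> bf bf'; have intf' := integrableC_bounded (cf' x x0x) bf'.
  have cif' : continuousC (fun t => 'i * f' x t).
    have [c1 c2] := cf' x x0x; split.
      under eq_fun do rewrite ReM /= mul0r mul1r sub0r.
      by move=> t; apply: cvgN; exact: c2.
    under eq_fun do rewrite ImM /= mul0r mul1r add0r.
    exact: c1.
  have := integralC_derivative_eq0 (fun t => dt x t x0x) cif' (integrableCZ 'i intf') bf.
  rewrite integralCZ// => /eqP; rewrite mulf_eq0 => /orP[|/eqP//].
  by rewrite eq_complex /= oner_eq0 andbF.
have cf x : x0 < x -> continuousC (f x).
  by move=> x0x; apply: (derC_continuousC (d := fun t => 'i * f' x t)) => t; exact: dt.
apply: complex_eq => /=.
- apply: (@Rintegral_line_cst (fun x t => Re (f x t)) (fun x t => Re (f' x t)) x0) => //.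
  + by move=> x t /(dx x t)[].
  + by move=> x /cf [c1 _]; exact: continuous_measurable_fun.
  + by move=> x /f'0 /(congr1 (@complex.Re R)).
  + move=> c d c0; have [K HK] := fK c d c0; exists K => x t /HK[b1 b2].
    by split; rewrite (le_trans (normc_ge_Re _)).
- apply: (@Rintegral_line_cst (fun x t => Im (f x t)) (fun x t => Im (f' x t)) x0) => //.
  + by move=> x t /(dx x t)[].
  + by move=> x /cf [_ c2]; exact: continuous_measurable_fun.
  + by move=> x /f'0 /(congr1 (@complex.Im R)).
  + move=> c d c0; have [K HK] := fK c d c0; exists K => x t /HK[b1 b2].
    by split; rewrite (le_trans (normc_ge_Im _)).
Qed.

End ContourShift.

(** * The integrals G: bounds, independence of sigma, functional equation *)

Section GIntegrals.
Context {R : realType}.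
Implicit Types (x y t sigma : R) (z h : R[i]).

Lemma expr_le_expR n x : 0 <= x -> x ^+ n <= n`!%:R * expR x.
Proof.
move=> x0; case: n => [|n].
  by rewrite expr0 fact0 mul1r -expR0 ler_expR.
rewrite -ler_pdivrMl ?ltr0n ?fact_gt0// mulrC.
by rewrite (le_trans _ (expR_ge1Dxn n x0))// lerDr.
Qed.

Lemma ler_expR_id x : x <= expR x.
Proof. by rewrite (le_trans _ (expR_ge1Dx x))// lerDr. Qed.

Lemma ln_one_sqr_ge0 t : 0 <= ln (1 + t ^+ 2).
Proof. by rewrite ln_ge0// lerDl sqr_ge0. Qed.

(** A Gaussian beats any power of 1 + t ^ 2, with one more power to spare for the denominator. *)
Lemma expR_log_gauss_bound (A k : R) : 0 <= k ->
  exists K, forall t, expR (A * (k + ln (1 + t ^+ 2)) - t ^+ 2) <= K / (1 + t ^+ 2).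
Proof.
move=> k0; pose N := Num.truncn A.
have AN : A <= N.+1%:R by rewrite ltW// truncnS_gt.
(* The + 1 pays for replacing - t ^ 2 by - (1 + t ^ 2); the factorial comes from y ^ (N + 2) <= (N +
   2)! e ^ y at y = 1 + t ^ 2. *)
exists (expR (N.+1%:R * k + 1) * N.+2`!%:R) => t.
have t0 := one_sqr_gt0 t.
rewrite ler_pdivlMr//.
apply: (@le_trans _ _ (expR (N.+1%:R * k + 1) *
    ((1 + t ^+ 2) ^+ N.+2 * expR (- (1 + t ^+ 2))))).
  have l0 := ln_one_sqr_ge0 t; set l := ln (1 + t ^+ 2) in l0 *.
  have lE : expR l = 1 + t ^+ 2 by rewrite /l lnK ?posrE.
  rewrite -{1 2}lE -expRM_natl -!expRD ler_expR -natr1.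
  have := mulr_ge0 k0 l0; have : (A - N.+1%:R) * (k + l) <= 0.
    by rewrite mulr_le0_ge0 ?addr_ge0// subr_le0.
  by move: (N.+1%:R : R) => M; nra.
rewrite ler_wpM2l ?expR_ge0// expRN ler_pdivrMr ?expR_gt0//.
by rewrite expr_le_expR// ltW.
Qed.

Lemma normc_LogC_bound (a b : R) : 0 < a ->
  exists2 k, 0 <= k & forall x t, a <= x <= b ->
    normc (LogC (x +i* t)) <= k + ln (1 + t ^+ 2).
Proof.
(* The terms bound, in turn, the logarithm of the modulus from below, the same from above together
   with ln (1 + t ^ 2), and the argument. *)
move=> a0; exists (`|ln a| + ln (1 + b ^+ 2) + pi).
  by rewrite addr_ge0 ?pi_ge0// addr_ge0 ?normr_ge0 ?ln_one_sqr_ge0.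
move=> x t /andP[ax xb]; rewrite (le_trans (normc_le_ReIm _))//=.
have x0 : 0 < x by exact: lt_le_trans ax.
have p0 : 0 < x ^+ 2 + t ^+ 2 by rewrite ltr_pwDl ?exprn_gt0 ?sqr_ge0.
have l1 : ln (x ^+ 2 + t ^+ 2) <= ln (1 + b ^+ 2) + ln (1 + t ^+ 2).
  rewrite -lnM ?posrE ?one_sqr_gt0// ler_ln ?posrE ?mulr_gt0 ?one_sqr_gt0//.
  have : x ^+ 2 <= b ^+ 2 by rewrite ler_pXn2r// nnegrE ltW// (lt_le_trans x0).
  have := sqr_ge0 t; have := sqr_ge0 b; have := mulr_ge0 (sqr_ge0 b) (sqr_ge0 t); nra.
have l2 : 2 * ln a <= ln (x ^+ 2 + t ^+ 2).
  rewrite mulr_natl -lnXn// ler_ln ?posrE ?exprn_gt0//.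
  by rewrite (@le_trans _ _ (x ^+ 2)) ?lerDl ?sqr_ge0// ler_pXn2r// nnegrE ltW.
have l3 := ler_norm (- ln a); rewrite normrN in l3.
have l4 := ln_one_sqr_ge0 b; have l5 := ln_one_sqr_ge0 t.
have l6 : `|2^-1 * ln (x ^+ 2 + t ^+ 2)| <= `|ln a| + ln (1 + b ^+ 2) + ln (1 + t ^+ 2).
  by rewrite ler_norml; apply/andP; split; have := normr_ge0 (ln a); lra.
have l7 : `|atan (t / x)| <= pi.
  rewrite ler_norml; have := atan_gtNpi2 (t / x); have := atan_ltpi2 (t / x).
  by have := pi_gt0 R; move=> *; apply/andP; split; lra.
lra.
Qed.

Lemma derC_horizontal t x : derC (fun y => y +i* t) x 1.
Proof. by split; [exact: is_derive_id|exact: is_derive_cst]. Qed.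

Lemma derC_vertical x t : derC (fun y => x +i* y) t 'i.
Proof. by split; [exact: is_derive_cst|exact: is_derive_id]. Qed.

(** The integrand of G merged into one exponential of [LogC], so that a single chain rule
    differentiates it. *)
Definition Gfun z x t : R[i] := expC (2 * z * LogC (x +i* t) + (x +i* t) ^+ 2).

Lemma G_integrandE sigma z t : 0 < sigma -> G_integrand sigma z t = Gfun z sigma t.
Proof. by move=> s0; rewrite /G_integrand /powC logCE// /Gfun expCD. Qed.

Definition dGfun z x t : R[i] := Gfun z x t * (2 * z / (x +i* t) + 2 * (x +i* t)).

(** Stated along an arbitrary curve: the horizontal and vertical cases together are the
    Cauchy-Riemann equations. *)
Lemma derC_Gfun (c : R -> R[i]) t d z : 0 < Re (c t) -> derC c t d ->
  derC (fun s => expC (2 * z * LogC (c s) + c s ^+ 2)) t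
    (expC (2 * z * LogC (c t) + c t ^+ 2) * (d * (2 * z / c t + 2 * c t))).
Proof.
move=> c0 dc; apply: derC_expC.
have dc2 := derC_mul dc dc.
have h := derC_add (derC_mull (2 * z) (derC_LogC c0 dc)) dc2.
apply: (derC_eq (derC_ext _ h)); first by move=> s; rewrite expr2.
by field; exact: Re_gt0_neq0.
Qed.

Lemma derC_Gfun_horizontal z x t : 0 < x -> derC (fun y => Gfun z y t) x (dGfun z x t).
Proof.
move=> x0; apply: derC_eq (derC_Gfun (c := fun y => y +i* t) z x0 (derC_horizontal t x)) _.
by rewrite mul1r.
Qed.

Lemma derC_Gfun_vertical z x t : 0 < x -> derC (Gfun z x) t ('i * dGfun z x t).
Proof.
move=> x0; apply: derC_eq (derC_Gfun (c := fun y => x +i* y) z x0 (derC_vertical x t)) _.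
by rewrite /dGfun /Gfun mulrCA.
Qed.

Lemma GfunD z h x t : 0 < x -> Gfun (z + h) x t = Gfun z x t * expC (2 * h * LogC (x +i* t)).
Proof. by move=> x0; rewrite /Gfun -expCD; congr expC; ring. Qed.

Lemma Gfun_half z x t : 0 < x -> Gfun (z + 2^-1) x t = Gfun z x t * (x +i* t).
Proof. by move=> x0; rewrite GfunD// divff ?mul1r ?expC_LogC// pnatr_eq0. Qed.

(** Besides giving the functional equation, this removes the quotient from [dGfun], so that its
    continuity and bounds reduce to those of [Gfun]. *)
Lemma dGfunE z x t : 0 < x ->
  dGfun (z + 2^-1) x t = (2 * z + 1) * Gfun z x t + 2 * Gfun (z + 1) x t.
Proof.
move=> x0; have -> : z + 1 = z + 2^-1 + 2^-1 by field.
rewrite !Gfun_half// /dGfun Gfun_half//.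
by field; exact: (Re_gt0_neq0 (z := x +i* t)).
Qed.

Lemma continuousC_Gfun z x : 0 < x -> continuousC (Gfun z x).
Proof.
move=> x0; apply: (derC_continuousC (d := fun t => 'i * dGfun z x t)) => t.
exact: derC_Gfun_vertical.
Qed.

Lemma continuousC_add (f g : R -> R[i]) : continuousC f -> continuousC g ->
  continuousC (fun t => f t + g t).
Proof.
move=> [f1 f2] [g1 g2]; split.
  by under eq_fun do rewrite ReD; move=> t; apply: cvgD; [exact: f1|exact: g1].
by under eq_fun do rewrite ImD; move=> t; apply: cvgD; [exact: f2|exact: g2].
Qed.

Lemma continuousC_mull z (f : R -> R[i]) : continuousC f -> continuousC (fun t => z * f t).
Proof.
move=> [f1 f2]; split.
  under eq_fun do rewrite ReM; move=> t.
  by apply: cvgB; (apply: cvgM; [exact: cvg_cst|]); [exact: f1|exact: f2].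
under eq_fun do rewrite ImM; move=> t.
by apply: cvgD; (apply: cvgM; [exact: cvg_cst|]); [exact: f2|exact: f1].
Qed.

Lemma continuousC_ext (f g : R -> R[i]) : (forall t, f t = g t) ->
  continuousC f -> continuousC g.
Proof. by move=> h; rewrite (_ : g = f)//; apply/funext => t; rewrite h. Qed.

Lemma continuousC_dGfun z x : 0 < x -> continuousC (dGfun z x).
Proof.
move=> x0; apply: (continuousC_ext (f := fun t => (2 * (z - 2^-1) + 1) * Gfun (z - 2^-1) x t
    + 2 * Gfun (z - 2^-1 + 1) x t)).
  by move=> t; rewrite -dGfunE// subrK.
by apply: continuousC_add; apply: continuousC_mull; exact: continuousC_Gfun.
Qed.

(* The loss k + ln (1 + t ^+ 2) dominates the logarithm uniformly on a strip, so
   powers of w and of LogC w only change the factor A in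
   expR (A * (k + ln (1 + t ^+ 2)) - t ^+ 2). *)
Lemma Gfun_log_bound (a b : R) z : 0 < a -> exists2 k, 0 <= k &
  (forall x t, a <= x <= b -> normc (LogC (x +i* t)) <= k + ln (1 + t ^+ 2)) /\
  (forall x t, a <= x <= b -> normc (Gfun z x t) <=
    expR (b ^+ 2) * expR (2 * normc z * (k + ln (1 + t ^+ 2)) - t ^+ 2)).
Proof.
move=> a0; have [k k0 hk] := normc_LogC_bound b a0; exists k => //; split=> // x t axb.
have /andP[ax xb] := axb.
rewrite normc_expC -expRD ler_expR ReD ReX2 /= addrCA addrA.
have : Re (2 * z * LogC (x +i* t)) <= 2 * normc z * (k + ln (1 + t ^+ 2)).
  rewrite (le_trans (ler_norm _))// (le_trans (normc_ge_Re _))//.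
  rewrite !ComplexField.Normc.normcM -natC normc_real ger0_norm//.
  by rewrite ler_wpM2l ?mulr_ge0 ?normc_ge0// hk.
have : x ^+ 2 <= b ^+ 2 by rewrite ler_pXn2r// nnegrE ltW// (lt_le_trans a0)// (le_trans ax).
move=> /=; lra.
Qed.

Lemma cauchy_bounded_exp (f : R -> R -> R[i]) (P : R -> Prop) (A B k : R) :
  0 <= k -> 0 <= B ->
  (forall x t, P x -> normc (f x t) <= B * expR (A * (k + ln (1 + t ^+ 2)) - t ^+ 2)) ->
  exists K, forall x, P x -> cauchy_bounded (f x) K.
Proof.
move=> k0 B0 h; have [K hK] := expR_log_gauss_bound A k0.
exists (B * K) => x Px t; rewrite (le_trans (h x t Px))// -mulrA.
by rewrite ler_wpM2l.
Qed.

Lemma Gfun_bounded (a b : R) z : 0 < a -> exists K, forall x, a <= x <= b ->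
  cauchy_bounded (Gfun z x) K.
Proof.
move=> a0; have [k k0 [_ h]] := Gfun_log_bound b z a0.
by apply: (cauchy_bounded_exp k0 (expR_ge0 (b ^+ 2))) => x t; exact: h.
Qed.

Lemma dGfun_bounded (a b : R) z : 0 < a -> exists K, forall x, a <= x <= b ->
  cauchy_bounded (dGfun z x) K.
Proof.
move=> a0.
have [K1 h1] := Gfun_bounded b (z - 2^-1) a0.
have [K2 h2] := Gfun_bounded b (z - 2^-1 + 1) a0.
exists (normc (2 * (z - 2^-1) + 1) * K1 + 2 * K2) => x axb t.
have x0 : 0 < x by case/andP: axb => ax _; exact: lt_le_trans ax.
rewrite -{1}(subrK 2^-1 z) dGfunE//.
rewrite (le_trans (le_normcD _ _))// !ComplexField.Normc.normcM.
have -> : normc (2 : R[i]) = 2 by rewrite -natC normc_real ger0_norm.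
rewrite [leRHS]mulrDl -[X in _ <= X + _]mulrA -[X in _ <= _ + X]mulrA.
by apply: lerD; rewrite ler_wpM2l ?normc_ge0//; [exact: h1|exact: h2].
Qed.

Lemma GE sigma z : 0 < sigma -> G sigma z = integralC setT (Gfun z sigma).
Proof. by move=> s0; apply: eq_integralC => t _; exact: G_integrandE. Qed.

Lemma integrableC_Gfun z x : 0 < x -> integrableC setT (Gfun z x).
Proof.
move=> x0; have [K /(_ x)] := Gfun_bounded x z x0; rewrite lexx => /(_ isT) h.
exact: (integrableC_bounded (continuousC_Gfun z x0) h).
Qed.

Lemma integrableC_dGfun z x : 0 < x -> integrableC setT (dGfun z x).
Proof.
move=> x0; have [K /(_ x)] := dGfun_bounded x z x0; rewrite lexx => /(_ isT) h.
exact: (integrableC_bounded (continuousC_dGfun z x0) h).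
Qed.

Lemma integrableC_G_integrand sigma z : 0 < sigma ->
  integrableC setT (G_integrand sigma z).
Proof.
move=> s0; apply: (eq_integrableC (f := Gfun z sigma)).
  by move=> t; rewrite G_integrandE.
exact: integrableC_Gfun.
Qed.

Lemma G_sigma_independent z (x y : R) : 0 < x -> 0 < y -> G x z = G y z.
Proof.
move=> x0 y0; rewrite !GE//.
apply: (@contour_shift _ (Gfun z) (dGfun z) 0) => //.
- by move=> *; exact: derC_Gfun_horizontal.
- by move=> *; exact: derC_Gfun_vertical.
- by move=> *; exact: continuousC_dGfun.
move=> a b a0; have [K1 h1] := Gfun_bounded b z a0; have [K2 h2] := dGfun_bounded b z a0.
exists (Num.max K1 K2) => s sab; split=> t.
  rewrite (le_trans (h1 s sab t))// ler_wpM2r ?invr_ge0 ?(ltW (one_sqr_gt0 _))//.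
  by rewrite le_max lexx.
rewrite (le_trans (h2 s sab t))// ler_wpM2r ?invr_ge0 ?(ltW (one_sqr_gt0 _))//.
by rewrite le_max lexx orbT.
Qed.

Lemma G_succ sigma z : 0 < sigma -> G sigma (z + 1) = - (z + 2^-1) * G sigma z.
Proof.
move=> s0; rewrite !GE//.
have [K /(_ sigma)] := Gfun_bounded sigma (z + 2^-1) s0; rewrite lexx => /(_ isT) hK.
have e : integralC setT (fun t => 'i * dGfun (z + 2^-1) sigma t) = 0.
  apply: (integralC_derivative_eq0 _ _ _ hK).
  - by move=> t; exact: derC_Gfun_vertical.
  - by apply: continuousC_mull; exact: continuousC_dGfun.
  - by apply: integrableCZ; exact: integrableC_dGfun.
rewrite integralCZ in e; last exact: integrableC_dGfun.
move/eqP: e; rewrite mulf_eq0 {1}eq_complex /= oner_eq0 andbF /= => /eqP.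
rewrite (@eq_integralC _ _ _ (fun t => (2 * z + 1) * Gfun z sigma t
  + 2 * Gfun (z + 1) sigma t)); last by move=> t _; rewrite dGfunE.
rewrite integralCD; try by apply: integrableCZ; exact: integrableC_Gfun.
rewrite !integralCZ; try exact: integrableC_Gfun.
move=> e; apply: (@mulfI _ 2); first by rewrite pnatr_eq0.
apply/eqP; rewrite -subr_eq0; apply/eqP; rewrite -[RHS]e.
by field.
Qed.

End GIntegrals.

(** * G is entire *)

Section Entire.
Context {R : realType}.
Implicit Types (z w h : R[i]) (x t sigma : R).

(** The mean value equality fails for complex values, so it is applied to both components; hence the
    factor 2. *)
Lemma normc_le_MVT (c c' : R -> R[i]) (M : R) : (forall x, derC c x (c' x)) ->
  (forall x, 0 <= x <= 1 -> normc (c' x) <= M) -> normc (c 1 - c 0) <= 2 * M.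
Proof.
move=> dc cM.
have b (g g' : R -> R) : (forall x, is_derive x 1 g (g' x)) ->
    (forall x, `|g' x| <= normc (c' x)) -> `|g 1 - g 0| <= M.
  move=> dg gc; have [|y] := @MVT_segment _ g g' 0 1 ler01 (fun x _ => dg x).
  - by apply: continuous_subspaceT => x; exact: (is_derive_continuous (dg x)).
  rewrite in_itv/= => y01 ->; rewrite subr0 mulr1 (le_trans (gc y))//.
  exact: cM.
rewrite (le_trans (normc_le_ReIm _))// !ReImE.
have -> : 2 * M = M + M by ring.
apply: lerD.
- apply: (b (fun x => Re (c x)) (fun x => Re (c' x))) => x; first by case: (dc x).
  exact: normc_ge_Re.
- apply: (b (fun x => Im (c x)) (fun x => Im (c' x))) => x; first by case: (dc x).
  exact: normc_ge_Im.
Qed.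

Lemma derC_realM z x : derC (fun y => y%:C * z) x z.
Proof.
apply: derC_eq (derC_mul (derC_realid x) (derC_cst z x)) _.
by rewrite mul1r mulr0 addr0.
Qed.

Lemma normc_realM x z : 0 <= x <= 1 -> normc (x%:C * z) <= normc z.
Proof.
move=> /andP[x0 x1]; rewrite ComplexField.Normc.normcM normc_real ger0_norm//.
by rewrite ler_piMl ?normc_ge0.
Qed.

Lemma normc_expC_sub1 z : normc (expC z - 1) <= 2 * (normc z * expR (normc z)).
Proof.
have := @normc_le_MVT (fun x => expC (x%:C * z)) (fun x => expC (x%:C * z) * z)
  (normc z * expR (normc z)) (fun x => derC_expC (derC_realM z x)).
rewrite mul1r mul0r expC0; apply=> x x01.
rewrite ComplexField.Normc.normcM mulrC ler_wpM2l ?normc_ge0//.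
by rewrite (le_trans (normc_expC_le _))// ler_expR normc_realM.
Qed.

(** Along the segment from 0 to z the derivative is (e ^ (x z) - 1) z, to which the first-order
    bound applies; two mean value estimates give 4 = 2 * 2. *)
Lemma normc_expC_sub1_sub z :
  normc (expC z - 1 - z) <= 4 * (normc z ^+ 2 * expR (normc z)).
Proof.
have d x : derC (fun y => expC (y%:C * z) - y%:C * z) x ((expC (x%:C * z) - 1) * z).
  apply: derC_eq (derC_add (derC_expC (derC_realM z x)) (derC_opp (derC_realM z x))) _.
  by rewrite mulrBl mul1r.
have := normc_le_MVT (M := 2 * (normc z ^+ 2 * expR (normc z))) d.
rewrite mul1r mul0r expC0 subr0 => h.
have -> : expC z - 1 - z = expC z - z - 1 by ring.
have -> : 4 * (normc z ^+ 2 * expR (normc z)) =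
  2 * (2 * (normc z ^+ 2 * expR (normc z))) by ring.
apply: h => x x01.
rewrite ComplexField.Normc.normcM (le_trans (ler_wpM2r _ (normc_expC_sub1 _))) ?normc_ge0//.
rewrite -mulrA ler_wpM2l// expr2 -[leRHS]mulrA [leRHS]mulrCA mulrC ler_wpM2l ?normc_ge0//.
by rewrite ler_pM ?normc_ge0 ?expR_ge0 ?ler_expR ?normc_realM.
Qed.

(** A derivative with an explicit quadratic remainder. Unlike a limit, such a bound can simply be
    integrated. *)
Definition quadratic_approx (f : R[i] -> R[i]) : Prop :=
  forall z, exists D, exists2 K, 0 <= K & forall h, normc h <= 1 ->
    normc (f (z + h) - f z - h * D) <= K * normc h ^+ 2.

Lemma entire_quadratic (f : R[i] -> R[i]) : quadratic_approx f -> entire f.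
Proof.
move=> qf z; have [D [K K0 hK]] := qf z; apply/cvg_ex; exists D.
apply/cvgrPdist_le => /= e e0.
(* In the order of [R[i]], 0 < e forces e to be real. *)
have eE : e = (Re e)%:C by case: e e0 => a b; rewrite ltcE /= => /andP[/eqP -> _].
have e0' : 0 < Re e by move: e0; rewrite eE ltcR.
pose d := Num.min 1 (Re e / (K + 1)).
have d0 : 0 < d by rewrite lt_min ltr01 divr_gt0// ltr_pwDr.
have N1 : \forall h \near (0 : R[i]^o)^', h != 0 := nbhs_dnbhs_neq 0.
have N2 : \forall h \near (0 : R[i]^o)^', `|h| <= d%:C by apply: dnbhs0_le; rewrite ltcR.
apply: filterS2 N1 N2 => h h0; rewrite normr_normc lecR => hd.
have hd1 : normc h <= 1 by rewrite (le_trans hd)// ge_min lexx.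
have hd2 : normc h <= Re e / (K + 1) by rewrite (le_trans hd)// ge_min lexx orbT.
rewrite eE normr_normc lecR.
have -> : D - h^-1 *: (f (h *: (1 : R[i]^o) + z) - f z) =
    - (h^-1 * (f (z + h) - f z - h * D)).
  by rewrite /GRing.scale/= mulr1 addrC (addrC h); field.
rewrite normcN ComplexField.Normc.normcM ComplexField.Normc.normcV.
have hn : 0 < normc h by rewrite lt0r normc_eq0 h0 normc_ge0.
rewrite ler_pdivrMl// (le_trans (hK h hd1))// expr2 mulrA (mulrC (normc h)).
rewrite ler_wpM2r ?normc_ge0//.
apply: (@le_trans _ _ ((K + 1) * normc h)).
  by rewrite ler_wpM2r ?normc_ge0// lerDl.
by rewrite mulrC -ler_pdivlMr// ltr_pwDr.
Qed.

(** With |b| = 1 the increment b h stays in the unit disc and the quadratic term keeps its size; the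
    cases needed are b = 1 and b = -1. *)
Lemma quadratic_approx_affine (f : R[i] -> R[i]) (a b c : R[i]) : normc b = 1 ->
  quadratic_approx f -> quadratic_approx (fun z => c * f (a + b * z)).
Proof.
move=> b1 qf z; have [D [K K0 hK]] := qf (a + b * z).
exists (c * b * D); exists (normc c * K); first by rewrite mulr_ge0 ?normc_ge0.
move=> h h1.
have -> : c * f (a + b * (z + h)) - c * f (a + b * z) - h * (c * b * D) =
    c * (f (a + b * z + b * h) - f (a + b * z) - b * h * D).
  by rewrite mulrDr addrA; ring.
rewrite ComplexField.Normc.normcM -[leRHS]mulrA ler_wpM2l ?normc_ge0//.
by have := hK (b * h); rewrite ComplexField.Normc.normcM b1 mul1r; apply.
Qed.

(** The derivative is the integral of [D1], the z-derivative of the integrand. The remainder [E h]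
    is [Gfun z] times the second-order remainder of the exponential at 2 h log w. *)
Lemma G_quadratic_approx sigma : 0 < sigma -> quadratic_approx (G sigma).
Proof.
move=> s0 z.
have [k k0 [hL hG]] := Gfun_log_bound sigma z s0.
have ss : sigma <= sigma <= sigma by rewrite lexx.
pose L t := LogC (sigma +i* t).
pose E h t := Gfun z sigma t * (expC (2 * h * L t) - 1 - 2 * h * L t).
pose D1 t := Gfun z sigma t * (2 * L t).
have [K hK] : exists K, forall h, normc h <= 1 ->
    forall t, normc (E h t) <= normc h ^+ 2 * (K / (1 + t ^+ 2)).
  (* Of the extra exponent 3, 2 bounds e ^ |2 h log w| for |h| <= 1 and 1 absorbs |log w| ^ 2 <= 2 e
     ^ l. The factor 32 below is 4 * 2 ^ 2 * 2. *)
  have [K hK] := expR_log_gauss_bound (2 * normc z + 3) k0.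
  exists (expR (sigma ^+ 2) * 32 * K) => h h1 t.
  set l := k + ln (1 + t ^+ 2).
  have l0 : 0 <= l by rewrite addr_ge0// ln_one_sqr_ge0.
  have n2 : normc (2 * h * L t) = 2 * normc h * normc (L t).
    by rewrite !ComplexField.Normc.normcM -natC normc_real ger0_norm.
  have Ll : normc (L t) <= l by exact: hL.
  have h0 := normc_ge0 h; have L0 := normc_ge0 (L t).
  have A1 : normc (expC (2 * h * L t) - 1 - 2 * h * L t) <=
      normc h ^+ 2 * (32 * expR (3 * l)).
    rewrite (le_trans (normc_expC_sub1_sub _))// n2.
    have e1 : expR (2 * normc h * normc (L t)) <= expR (2 * l).
      by rewrite ler_expR -mulrA ler_wpM2l//; nra.
    have e2 : normc (L t) ^+ 2 <= 2 * expR l.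
      have := expr_le_expR 2 l0; rewrite (_ : 2`! = 2%N)// => e2.
      by rewrite (le_trans _ e2)// ler_pXn2r// nnegrE.
    have e3 : expR (3 * l) = expR l * expR (2 * l) by rewrite -expRD; congr expR; ring.
    rewrite e3 !exprMn.
    have -> : 4 * (2 ^+ 2 * normc h ^+ 2 * normc (L t) ^+ 2 * expR (2 * normc h * normc (L t)))
      = normc h ^+ 2 * (16 * (normc (L t) ^+ 2 * expR (2 * normc h * normc (L t)))) by ring.
    rewrite ler_wpM2l ?sqr_ge0//.
    have -> : 32 * (expR l * expR (2 * l)) = 16 * (2 * expR l * expR (2 * l)) by ring.
    by rewrite ler_wpM2l// ler_pM ?expR_ge0 ?sqr_ge0.
  rewrite ComplexField.Normc.normcM.
  apply: (le_trans (ler_pM (normc_ge0 _) (normc_ge0 _) (hG _ t ss) A1)).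
  rewrite [leLHS]mulrCA ler_wpM2l ?sqr_ge0//.
  have -> : expR (sigma ^+ 2) * expR (2 * normc z * l - t ^+ 2) * (32 * expR (3 * l)) =
      expR (sigma ^+ 2) * 32 * expR ((2 * normc z + 3) * l - t ^+ 2).
    rewrite (_ : (2 * normc z + 3) * l - t ^+ 2 = (2 * normc z * l - t ^+ 2) + 3 * l) ?expRD; ring.
  by rewrite -[leRHS]mulrA ler_wpM2l ?mulr_ge0 ?expR_ge0//; exact: hK.
have dE h t : E h t = Gfun (z + h) sigma t + (- Gfun z sigma t + - h * D1 t).
  by rewrite /E /D1 GfunD// /L; ring.
have iD1 : integrableC setT D1.
  have [K1 hK1] : exists K1, forall x, True -> cauchy_bounded D1 K1.
    apply: (cauchy_bounded_exp (f := fun=> D1) (A := 2 * normc z + 1)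
      (B := expR (sigma ^+ 2) * 2) k0); first by rewrite mulr_ge0 ?expR_ge0.
    move=> x t _; set l := k + ln (1 + t ^+ 2).
    rewrite !ComplexField.Normc.normcM -[in X in _ * (X * _)]natC normc_real ger0_norm//.
    rewrite mulrA (_ : (2 * normc z + 1) * l - t ^+ 2 = (2 * normc z * l - t ^+ 2) + l); last by ring.
    rewrite expRD mulrA ler_pM ?mulr_ge0 ?normc_ge0//.
      by rewrite mulrAC ler_wpM2r//; exact: hG.
    by rewrite (le_trans (hL _ t ss))// ler_expR_id.
  have cD1 : continuousC D1.
    apply: (derC_continuousC (d := fun t => 'i * dGfun z sigma t * (2 * L t) +
      Gfun z sigma t * (2 * ('i / (sigma +i* t))))) => t.
    apply: derC_mul; first exact: derC_Gfun_vertical.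
    apply: derC_mull.
    exact: (derC_LogC (c := fun y => sigma +i* y) s0 (derC_vertical _ _)).
  exact: (integrableC_bounded cD1 (hK1 0 I)).
exists (integralC setT D1); exists (2 * pi * `|K|).
  by rewrite mulr_ge0// mulr_ge0// pi_ge0.
move=> h h1.
have iE : integrableC setT (E h).
  apply: (eq_integrableC (f := fun t => Gfun (z + h) sigma t + (-1 * Gfun z sigma t + - h * D1 t))).
    by move=> t; rewrite dE mulN1r.
  by do 2?apply: integrableCD; try apply: integrableCZ; try exact: integrableC_Gfun.
have -> : G sigma (z + h) - G sigma z - h * integralC setT D1 = integralC setT (E h).
  rewrite !GE// (@eq_integralC _ _ (E h) (fun t => Gfun (z + h) sigma t +
    (-1 * Gfun z sigma t + - h * D1 t))); last by move=> t _; rewrite dE mulN1r.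
  have iG := @integrableC_Gfun R; have i1 := integrableCZ (-1) (iG z sigma s0).
  have i2 := integrableCZ (- h) iD1.
  by rewrite integralCD ?integralCD ?integralCZ//; [ring|exact: iG|exact: iG|exact: integrableCD].
rewrite -[leRHS]mulrA.
apply: (normc_integralC_le iE) => t; rewrite (le_trans (hK h h1 t))//.
rewrite (mulrC `|K|) -[leRHS]mulrA ler_wpM2l ?sqr_ge0// ler_wpM2r ?ler_norm//.
by rewrite invr_ge0 ltW// one_sqr_gt0.
Qed.

End Entire.

(** * The Euler integral on the whole line *)

Section EulerIntegral.
Context {R : realType}.
Implicit Types (u x t : R) (s z : R[i]).

(** For A = 0 this bounds the Euler integrand. The factor (1 + e ^ u) ^ A serves the cosine formula,
    where |w| ^ 2 is at most 1 + e ^ u. *)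
Lemma expR_gumbel_bound (r A : R) : 0 < r -> 0 <= A -> exists K, forall u,
  expR (r * u + A * ln (1 + expR u) - expR u) <= K / (1 + u ^+ 2).
Proof.
move=> r0 A0; pose M := (Num.truncn r).+1; pose N := (Num.truncn A).+1.
have rM : r <= M%:R by rewrite ltW// truncnS_gt.
have AN : A <= N%:R by rewrite ltW// truncnS_gt.
have l2 : 0 <= ln 2 :> R by rewrite ln_ge0// ler1n.
(* [K1] serves u <= 0, where e ^ (r u) decays. [K2] serves u > 0, where e ^ (- e ^ u) beats M + N +
   1 powers of e ^ u, the last of them paying for 1 + u ^ 2 <= 3 e ^ u. *)
pose K1 : R := expR (A * ln 2) * (1 + 2 / r ^+ 2).
pose K2 : R := 3 * expR (N%:R * ln 2) * (M + N + 1)`!%:R.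
have K10 : 0 <= K1 by rewrite mulr_ge0 ?expR_ge0// addr_ge0// divr_ge0// sqr_ge0.
have K20 : 0 <= K2 by rewrite mulr_ge0// mulr_ge0 ?expR_ge0.
exists (K1 + K2) => u; rewrite ler_pdivlMr ?one_sqr_gt0//.
have y0 := expR_gt0 u.
have [u0|u0] := leP u 0.
  rewrite (@le_trans _ _ K1) ?lerDl//.
  have y1 : expR u <= 1 by rewrite -expR0 ler_expR.
  have ly : ln (1 + expR u) <= ln 2.
    by rewrite ler_ln ?posrE ?addr_gt0//; lra.
  have e1 : expR (r * u + A * ln (1 + expR u) - expR u) <= expR (A * ln 2) * expR (r * u).
    rewrite -expRD ler_expR.
    by have := ler_wpM2l A0 ly; lra.
  rewrite (le_trans (ler_wpM2r (ltW (one_sqr_gt0 u)) e1))// -mulrA ler_wpM2l ?expR_ge0//.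
  have v0 : 0 <= - (r * u) by rewrite -mulrN mulr_ge0 ?oppr_ge0// ltW.
  have := expr_le_expR 2 v0; rewrite (_ : 2`! = 2%N)// expRN sqrrN exprMn => e2.
  have p0 := expR_gt0 (r * u).
  have e3 : u ^+ 2 * expR (r * u) <= 2 / r ^+ 2.
    rewrite ler_pdivlMr ?exprn_gt0// mulrAC (mulrC (u ^+ 2)).
    by rewrite -ler_pdivlMr.
  rewrite mulrDr mulr1 (mulrC _ (u ^+ 2)) lerD//.
  by rewrite -expR0 ler_expR; lra.
rewrite (@le_trans _ _ K2) ?lerDr//.
have y1 : 1 <= expR u by rewrite -expR0 ler_expR ltW.
have ly : ln (1 + expR u) <= ln 2 + u.
  rewrite -{2}(expRK u) -lnM ?posrE// ler_ln ?posrE ?mulr_gt0 ?addr_gt0//; lra.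
have ly0 : 0 <= ln (1 + expR u) by rewrite ln_ge0// lerDl ltW.
have e1 : r * u + A * ln (1 + expR u) <= N%:R * ln 2 + (M + N)%:R * u.
  rewrite natrD.
  have := ler_wpM2r (ltW u0) rM; have := ler_pM A0 ly0 AN ly; lra.
have e2 : 1 + u ^+ 2 <= 3 * expR u.
  have := expr_le_expR 2 (ltW u0); rewrite (_ : 2`! = 2%N)//; lra.
have e3 : expR u ^+ (M + N + 1) * expR (- expR u) <= (M + N + 1)`!%:R.
  by rewrite expRN ler_pdivrMr ?expR_gt0// expr_le_expR// ltW.
apply: (@le_trans _ _ (expR (N%:R * ln 2 + (M + N)%:R * u - expR u) * (3 * expR u))).
  rewrite ler_pM ?expR_ge0// ?(ltW (one_sqr_gt0 _))// ler_expR lerD2r//.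
rewrite !expRD (expRM_natl (M + N)) -[leRHS]mulrA.
have -> : expR (N%:R * ln 2) * expR u ^+ (M + N) * expR (- expR u) * (3 * expR u) =
  3 * (expR (N%:R * ln 2) * (expR u ^+ (M + N + 1) * expR (- expR u))).
  by rewrite addn1 exprSr; ring.
by rewrite ler_wpM2l// ler_wpM2l ?expR_ge0.
Qed.

(** The Euler integrand at x = e ^ u; the Jacobian turns the exponent s - 1 into s. *)
Definition Efun s u : R[i] := expC (s * u%:C - (expR u)%:C).

Lemma LogC_real x : 0 < x -> LogC x%:C = (ln x)%:C.
Proof.
move=> x0; apply: complex_eq.
  by rewrite Re_LogC// normc_real gtr0_norm.
by rewrite /= mul0r atan0.
Qed.

Lemma Euler_integralE s : Euler_integral s = integralC setT (Efun s).
Proof.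
pose f x := expC ((s - 1) * LogC x%:C - x%:C).
have -> : Euler_integral s = integralC `]0, +oo[ f.
  apply: eq_integralC => x /=; rewrite in_itv/= andbT => x0.
  by rewrite powC_pos// /f LogC_real// expCD.
have df x : 0 < x -> exists d, derC f x d.
  move=> x0; eexists; apply: derC_expC; apply: derC_add; last first.
    by apply: derC_opp; exact: derC_realid.
  apply: derC_mull; apply: (derC_LogC (c := fun y => y%:C)); first by [].
  exact: derC_realid.
rewrite (@integralC_expR _ 1)//; last first.
  by move=> x /df[d [d1 d2]]; split; exact: is_derive_continuous.
apply: eq_integralC => u _; rewrite !mul1r /f LogC_real ?expR_gt0// expRK.
rewrite -[X in _ * X]expC_real -expCD.
by congr expC; ring.
Qed.

(** Integration by parts in disguise: integrating this derivative over the line yields the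
    recurrence of the Euler integral. *)
Lemma derC_Efun s u : derC (Efun s) u (s * Efun s u - Efun (s + 1) u).
Proof.
have d := derC_expC (derC_add (derC_mull s (derC_realid u))
  (derC_opp (derC_real (is_derive_expR u)))).
apply: derC_eq d _.
rewrite /Efun (_ : (s + 1) * u%:C - (expR u)%:C = s * u%:C - (expR u)%:C + u%:C); last by ring.
by rewrite (expCD (_ - _) u%:C) expC_real; ring.
Qed.

Lemma continuousC_Efun s : continuousC (Efun s).
Proof. by apply: derC_continuousC => u; exact: derC_Efun. Qed.

Lemma normc_Efun s u : normc (Efun s u) = expR (Re s * u - expR u).
Proof. by rewrite normc_expC !ReImE /= mulr0 subr0. Qed.

Lemma Efun_bounded s : 0 < Re s -> exists K, cauchy_bounded (Efun s) K.
Proof.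
move=> s0; have [K hK] := expR_gumbel_bound s0 (lexx 0).
by exists K => u; rewrite normc_Efun; have := hK u; rewrite mul0r addr0.
Qed.

Lemma integrableC_Efun s : 0 < Re s -> integrableC setT (Efun s).
Proof.
by move=> s0; have [K] := Efun_bounded s0; apply: integrableC_bounded; exact: continuousC_Efun.
Qed.

Lemma Euler_integral_succ s : 0 < Re s ->
  Euler_integral (s + 1) = s * Euler_integral s.
Proof.
move=> s0; have s1 : 0 < Re (s + 1) by rewrite ReD /= addr_gt0.
rewrite !Euler_integralE.
have [K hK] := Efun_bounded s0.
have iE := integrableC_Efun s0; have iE1 := integrableC_Efun s1.
have ce u : s * Efun s u - Efun (s + 1) u = s * Efun s u + -1 * Efun (s + 1) u.
  by rewrite mulN1r.
have := integralC_derivative_eq0 (derC_Efun s) _ _ hK.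
under eq_fun do rewrite ce.
move=> e.
have {e} : integralC setT (fun u => s * Efun s u + -1 * Efun (s + 1) u) = 0.
  apply: e.
  - by apply: continuousC_add; apply: continuousC_mull; exact: continuousC_Efun.
  - by apply: integrableCD; exact: integrableCZ.
rewrite integralCD ?integralCZ ?mulN1r//; try exact: integrableCZ.
by move=> /eqP; rewrite subr_eq0 => /eqP.
Qed.

End EulerIntegral.

(** * Exchange of the order of integration *)

Section FubiniComplex.
Context {R : realType}.
Local Notation mu := (@lebesgue_measure R).

(** The inner integrals of the majorant [H] over x are themselves Cauchy bounded in y, so Tonelli
    gives the integrability on the product that Fubini requires. *)
Lemma Rintegral_Fubini (f H : R -> R -> R) (K : R) :
  measurable_fun setT (fun p : R * R => f p.1 p.2) ->
  (forall x, mu.-integrable setT (EFin \o f x)) ->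
  (forall y, mu.-integrable setT (EFin \o (f ^~ y))) ->
  (forall y, mu.-integrable setT (EFin \o (H ^~ y))) ->
  (forall x y, `|f x y| <= H x y) ->
  (forall y, Rintegral mu setT (H ^~ y) <= K / (1 + y ^+ 2)) ->
  Rintegral mu setT (fun x => Rintegral mu setT (f x)) =
  Rintegral mu setT (fun y => Rintegral mu setT (f ^~ y)).
Proof.
move=> mf i1 i2 iH fH HK.
have mF : measurable_fun setT (fun p : R * R => (f p.1 p.2)%:E) by exact/measurable_EFinP.
have e1 x : ((Rintegral mu setT (f x))%:E = \int[mu]_y (f x y)%:E)%E.
  by rewrite fineK//; exact: integrable_fin_num (i1 x).
have e2 y : ((Rintegral mu setT (f ^~ y))%:E = \int[mu]_x (f x y)%:E)%E.
  by rewrite fineK//; exact: integrable_fin_num (i2 y).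
have iF : (mu \x mu)%E.-integrable setT (fun p : R * R => (f p.1 p.2)%:E).
  apply/integrable21ltyP => //=.
  apply: (@le_lt_trans _ _ (\int[mu]_y (K / (1 + y ^+ 2))%:E)%E); last first.
    exact: integrable_lty (integrable_cauchy_density K).
  apply: ge0_le_integral => //.
  - by move=> y _; exact: integral_ge0.
  - have := @measurable_fun_fubini_tonelli_G _ _ _ _ R mu (fun p => `|(f p.1 p.2)%:E|%E).
    apply => //.
    by apply: measurableT_comp.
  - by apply/measurable_int; exact: integrable_cauchy_density.
  - move=> y _; apply: (@le_trans _ _ (Rintegral mu setT (H ^~ y))%:E); last by rewrite lee_fin.
    rewrite fineK; last exact: integrable_fin_num (iH y).
    apply: ge0_le_integral => //.
    + exact: (measurable_int mu (integrable_abse (i2 y))).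
    + exact: (measurable_int mu (iH y)).
    + by move=> x _; rewrite lee_fin.
rewrite /Rintegral; congr fine.
under eq_integral do rewrite -/(Rintegral _ _ _) e1.
under [RHS]eq_integral do rewrite -/(Rintegral _ _ _) e2.
exact: (Fubini iF).
Qed.

Lemma integralC_Fubini (F : R -> R -> R[i]) (H : R -> R -> R) (K : R) :
  measurable_fun setT (fun p : R * R => Re (F p.1 p.2)) ->
  measurable_fun setT (fun p : R * R => Im (F p.1 p.2)) ->
  (forall x, integrableC setT (F x)) -> (forall y, integrableC setT (F ^~ y)) ->
  (forall y, mu.-integrable setT (EFin \o (H ^~ y))) ->
  (forall x y, normc (F x y) <= H x y) ->
  (forall y, Rintegral mu setT (H ^~ y) <= K / (1 + y ^+ 2)) ->
  integralC setT (fun x => integralC setT (F x)) =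
  integralC setT (fun y => integralC setT (F ^~ y)).
Proof.
move=> m1 m2 i1 i2 iH FH HK; apply: complex_eq => /=.
- apply: (@Rintegral_Fubini (fun x y => Re (F x y)) H K) => //.
  + by move=> x; case: (i1 x).
  + by move=> y; case: (i2 y).
  + by move=> x y; rewrite (le_trans (normc_ge_Re _)).
- apply: (@Rintegral_Fubini (fun x y => Im (F x y)) H K) => //.
  + by move=> x; case: (i1 x).
  + by move=> y; case: (i2 y).
  + by move=> x y; rewrite (le_trans (normc_ge_Im _)).
Qed.

End FubiniComplex.

(** * The inner integral of the double integral *)

Section ReflectionProduct.
Context {R : realType}.
Local Notation mu := (@lebesgue_measure R).
Implicit Types (u x t : R) (s z c : R[i]).

(** The integrand of the Laplace integral of e ^ (- c x) over x > 0, at x = e ^ u; hence the value 1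
    / c. *)
Definition expexp c u : R[i] := expC (u%:C - (expR u)%:C * c).

Lemma normc_expexp c u : normc (expexp c u) = expR (u - expR u * Re c).
Proof. by rewrite normc_expC !ReImE /= mul0r subr0. Qed.

Lemma expexp_bounded c : 0 < Re c -> exists K, cauchy_bounded (expexp c) K.
Proof.
move=> c0; set q := Re c in c0 *.
have [K hK] := expR_gumbel_bound (@ltr01 R) (lexx 0).
pose l := ln q.
(* Shifting u by l = ln q reduces to q = 1; the cost of the shift is 1 + u ^ 2 <= (2 + 2 l ^ 2) (1 +
   (u + l) ^ 2). *)
exists (expR (- l) * (K * (2 + 2 * l ^+ 2))) => u; rewrite normc_expexp -/q.
have -> : u - expR u * q = - l + ((u + l) - expR (u + l)).
  by rewrite expRD /l lnK ?posrE//; ring.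
have := hK (u + l); rewrite mul1r mul0r addr0 => h.
have p1 := one_sqr_gt0 (u + l); have p2 := one_sqr_gt0 u.
have K0 : 0 <= K.
  by have := le_trans (expR_ge0 _) h; rewrite pmulr_lge0// invr_gt0.
rewrite (expRD (- l)) -[leRHS]mulrA ler_wpM2l ?expR_ge0// (le_trans h)// -[leRHS]mulrA ler_wpM2l//.
rewrite ler_pdivlMr// mulrC ler_pdivrMr//.
by have := sqr_ge0 (u + 2 * l); have := mulr_ge0 (sqr_ge0 l) (sqr_ge0 (u + l)); nra.
Qed.

Lemma derC_expexp c u : c != 0 ->
  derC (fun y => - (expC (- ((expR y)%:C * c)) / c)) u (expexp c u).
Proof.
move=> c0.
have d := derC_opp (derC_mul (derC_expC (derC_opp (derC_mul (derC_real (is_derive_expR u))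
  (derC_cst c u)))) (derC_cst c^-1 u)).
apply: derC_eq d _.
by rewrite /expexp expCD expC_real !mulr0 !addr0; field.
Qed.

Lemma continuousC_expexp c : continuousC (expexp c).
Proof.
have d u : exists d, derC (expexp c) u d.
  eexists; apply: derC_expC; apply: derC_add; first exact: derC_realid.
  apply: derC_opp; apply: derC_mul; last exact: derC_cst.
  by apply: derC_real; exact: is_derive_expR.
by split=> u; have [e [d1 d2]] := d u; exact: is_derive_continuous.
Qed.

Lemma integrableC_expexp c : 0 < Re c -> integrableC setT (expexp c).
Proof.
move=> c0; have [K] := expexp_bounded c0.
by apply: integrableC_bounded; exact: continuousC_expexp.
Qed.

Lemma integral_expexp c : 0 < Re c -> integralC setT (expexp c) = c^-1.
Proof.
move=> c0; have cn := Re_gt0_neq0 c0.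
have h := integralC_FTC (fun t => derC_expexp t cn) (continuousC_expexp c)
  (integrableC_expexp c0).
have cE : cvgC (fun n => (expR (- n%:R))%:C) (0 : R)%:C.
  apply: cvgC_real; apply: (@squeeze_cvgr _ _ _ _ (fun=> 0) (fun n => n.+1%:R^-1)).
  - apply: nearW => n; rewrite expR_ge0 /= expRN lef_pV2 ?posrE ?expR_gt0//.
    by rewrite -natr1 addrC expR_ge1Dx.
  - exact: cvg_cst.
  - exact: cvg_harmonic.
rewrite (h (- c^-1) 0); first by rewrite sub0r opprK.
  have -> : - c^-1 = -1 * (expC (-1 * ((0 : R)%:C * c)) * c^-1).
    by rewrite (_ : (0 : R)%:C = 0)// mul0r mulr0 expC0 mul1r mulN1r.
  apply: (cvgC_ext (u := fun n => -1 * (expC (-1 * ((expR (- n%:R))%:C * c)) * c^-1))).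
    by move=> n; rewrite !mulN1r.
  apply: cvgC_mul; first exact: cvgC_cst.
  apply: cvgC_mul; last exact: cvgC_cst.
  apply: cvgC_expC; apply: cvgC_mul; first exact: cvgC_cst.
  by apply: cvgC_mul; last exact: cvgC_cst.
(* From e ^ (- y) <= 1 / y at y = e ^ n Re c, with e ^ n >= n + 1. *)
apply: (@cvgC_norm0 _ _ (fun n => (Re c)^-1 * normc c^-1 * n.+1%:R^-1)).
  move=> n; rewrite normcN ComplexField.Normc.normcM normc_expC mulrAC.
  rewrite ler_wpM2r ?normc_ge0// !ReImE /= mul0r subr0 expRN -invfM.
  rewrite lef_pV2 ?posrE ?expR_gt0 ?mulr_gt0 ?ltr0n// (le_trans _ (ler_expR_id _))//.
  by have := expR_ge1Dx (n%:R : R); rewrite -natr1; nra.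
rewrite -[X in _ --> X](mulr0 ((Re c)^-1 * normc c^-1)).
by apply: cvgM; [exact: cvg_cst|exact: cvg_harmonic].
Qed.

End ReflectionProduct.

(** * The product of the Euler integral and G as a single line integral *)

Section ReflectionFormula.
Context {R : realType}.
Local Notation mu := (@lebesgue_measure R).
Implicit Types (u x t : R) (s z c w : R[i]).

(** The modulus is |w| ^ (1 - 2 Re s) e ^ (2 Im s arg w). One factor 1 / |w| gives 1 / x; the
    remaining exponent 2 - 2 Re s is at most 0, so |w| >= 1/2 bounds that power by 2 ^ (2 Re s -
    2). *)
Lemma normc_power_bound s : 1 <= Re s -> exists2 M, 0 <= M &
  forall x t, 2^-1 <= x -> normc (expC ((1 - 2 * s) * LogC (x +i* t))) <= M / x.
Proof.
move=> s1; exists (expR ((2 * Re s - 2) * ln 2 + 2 * pi * `|Im s|)); first exact: expR_ge0.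
move=> x t x2; have x0 : 0 < x by lra.
rewrite normc_expC -[X in _ / X]lnK ?posrE// -expRN -expRD ler_expR.
rewrite ReM Re_LogC// !ReImE /=.
set N := Num.sqrt _.
have Nx : x <= N.
  by rewrite (le_trans (ler_norm x))// -sqrtr_sqr /N ler_wsqrtr// lerDl sqr_ge0.
have lN : ln x <= ln N by rewrite ler_ln ?posrE// (lt_le_trans x0).
have l2 : - ln 2 <= ln x.
  rewrite -lnV ?posrE// ler_ln ?posrE//.
have a1 := atan_gtNpi2 (t / x); have a2 := atan_ltpi2 (t / x).
have b : `|Im s * atan (t / x)| <= pi * `|Im s|.
  rewrite normrM mulrC ler_wpM2r// ler_norml; have := pi_gt0 R.
  by move=> p0; apply/andP; split; lra.
have := ler_norm (Im s * atan (t / x)).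
have := ler_wpM2l (_ : 0 <= 2 * Re s - 2) (le_trans l2 lN); rewrite subr_ge0.
have -> : (2 <= 2 * Re s) by lra.
move=> /(_ isT) e1 e2; lra.
Qed.

Lemma LogC_scale x w : 0 < x -> 0 < Re w -> LogC (x%:C * w) = (ln x)%:C + LogC w.
Proof.
move=> x0 w0; have xw0 : 0 < Re (x%:C * w) by rewrite ReM /= mul0r subr0 mulr_gt0.
have wn : 0 < normc w by rewrite lt0r normc_ge0 normc_eq0 Re_gt0_neq0.
apply: complex_eq; rewrite ?ReD ?ImD.
  rewrite !Re_LogC// ComplexField.Normc.normcM normc_real gtr0_norm// lnM ?posrE//.
rewrite /= !ReImE /= !mul0r subr0 addr0 add0r; congr atan.
by field; rewrite !gt_eqF.
Qed.

Lemma derC_power_vertical z x t : 0 < x ->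
  derC (fun y => z * LogC (x +i* y)) t (z * ('i / (x +i* t))).
Proof.
move=> x0; apply: derC_mull.
exact: (derC_LogC (c := fun y => x +i* y) x0 (derC_vertical _ _)).
Qed.

Lemma measurable_expexp_param (A B : R -> R[i]) : continuousC A -> continuousC B ->
  measurable_fun setT (fun p : R * R => Re (expC (A p.2) * expexp (B p.2) p.1)) /\
  measurable_fun setT (fun p : R * R => Im (expC (A p.2) * expexp (B p.2) p.1)).
Proof.
move=> [a1 a2] [b1 b2].
have ms (g : R -> R) : continuous g -> measurable_fun setT (fun p : R * R => g p.2).
  move=> cg; apply: measurableT_comp; last exact: measurable_snd.
  exact: continuous_measurable_fun.
have m1 : measurable_fun setT (fun p : R * R => p.1) by exact: measurable_fst.
have me : measurable_fun setT (fun p : R * R => expR p.1).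
  by apply: measurableT_comp.
have mRe : measurable_fun setT (fun p : R * R => expR (Re (A p.2) + (p.1 - expR p.1 * Re (B p.2)))).
  apply: measurableT_comp => //; apply: measurable_funD; first exact: (ms (fun t => Re (A t))).
  apply: measurable_funB => //; apply: measurable_funM => //; exact: (ms (fun t => Re (B t))).
have mIm : measurable_fun setT (fun p : R * R => Im (A p.2) - expR p.1 * Im (B p.2)).
  apply: measurable_funB; first exact: (ms (fun t => Im (A t))).
  by apply: measurable_funM => //; exact: (ms (fun t => Im (B t))).
have E p : expC (A p.2) * expexp (B p.2) p.1 =
    expC (A p.2 + (p.1%:C - (expR p.1)%:C * B p.2)) by rewrite expCD.
split; under eq_fun do rewrite E /= !ReImE /= !mul0r subr0 addr0 sub0r.
- apply: measurable_funM => //; apply: measurableT_comp mIm.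
  exact: continuous_measurable_fun (@continuous_cos R).
- apply: measurable_funM => //; apply: measurableT_comp mIm.
  exact: continuous_measurable_fun (@continuous_sin R).
Qed.

Lemma Re_one_sub_sqr (x t : R) : Re (1 - (x +i* t) ^+ 2) = 1 - x ^+ 2 + t ^+ 2.
Proof. by rewrite ReD ReN ReX2 /=; ring. Qed.

Lemma continuousC_one_sub_sqr x : continuousC (fun t => 1 - (x +i* t) ^+ 2).
Proof.
apply: (derC_continuousC (d := fun t => 0 - ('i * (x +i* t) + (x +i* t) * 'i))) => t.
apply: derC_add; first exact: derC_cst.
apply: derC_opp.
apply: derC_ext (derC_mul (derC_vertical x t) (derC_vertical x t)) => y.
by rewrite expr2.
Qed.

(** Replacing w by e ^ (u / 2) w turns e ^ (s u) into e ^ u and merges both exponentials into e ^ (-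
    e ^ u (1 - w ^ 2)). The inner integral over u is then that of [expexp] at 1 - w ^ 2, whose real
    part is positive because x < 1. *)
Lemma Euler_integral_mul_G s x : 1 <= Re s -> 2^-1 <= x < 1 ->
  Euler_integral s * G x (2^-1 - s) =
  integralC setT (fun t => expC ((1 - 2 * s) * LogC (x +i* t)) / (1 - (x +i* t) ^+ 2)).
Proof.
move=> s1 /andP[x2 x1]; have x0 : 0 < x by lra.
have [M M0 hM] := normc_power_bound s1.
have [s0 dlt0] : 0 < Re s /\ 0 < 1 - x ^+ 2 by split; [lra|nra].
pose A t := (1 - 2 * s) * LogC (x +i* t).
pose B t := 1 - (x +i* t) ^+ 2.
pose F u t := expC (A t) * expexp (B t) u.
have cA : continuousC A.
  by apply: derC_continuousC => t; exact: derC_power_vertical.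
have cB : continuousC B := continuousC_one_sub_sqr x.
have B0 t : 0 < Re (B t) by rewrite Re_one_sub_sqr; have := sqr_ge0 t; lra.
have Mx (t : R) : normc (expC (A t)) <= M / x := hM x t x2.
have Mx0 : 0 <= M / x by rewrite divr_ge0// ltW.
have iF1 u : integrableC setT (F u).
  have cF : continuousC (F u).
    apply: (derC_continuousC (d := fun t => expC (A t + (u%:C - (expR u)%:C * B t)) *
      ((1 - 2 * s) * ('i / (x +i* t)) +
        (0 - (expR u)%:C * (0 - ('i * (x +i* t) + (x +i* t) * 'i)))))) => t.
    apply: (derC_ext (c := fun t => expC (A t + (u%:C - (expR u)%:C * B t)))).
      by move=> y; rewrite /F expCD.
    apply: derC_expC; apply: derC_add; first exact: derC_power_vertical.
    apply: derC_add; first exact: derC_cst.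
    apply: derC_opp; apply: derC_mull.
    apply: derC_add; first exact: derC_cst.
    apply: derC_opp.
    apply: derC_ext (derC_mul (derC_vertical x t) (derC_vertical x t)) => y.
    by rewrite expr2.
  (* Here u is fixed. The constant comes from e ^ (- y) (1 + y) <= 1 at y = e ^ u t ^ 2 and from 1 +
     t ^ 2 <= (1 + e ^ (- u)) (1 + e ^ u t ^ 2). *)
  apply: (integrableC_bounded (K := M / x * (expR u * (1 + expR (- u)))) cF) => t.
  rewrite /F ComplexField.Normc.normcM -[leRHS]mulrA.
  apply: ler_pM; [exact: normc_ge0|exact: normc_ge0|exact: Mx|].
  rewrite normc_expexp Re_one_sub_sqr expRD -[leRHS]mulrA ler_wpM2l ?expR_ge0//.
  rewrite ler_pdivlMr ?one_sqr_gt0//.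
  have y0 := expR_gt0 u; have t0 := sqr_ge0 t.
  have e1 : expR (- (expR u * (1 - x ^+ 2 + t ^+ 2))) * (1 + expR u * t ^+ 2) <= 1.
    rewrite expRN mulrC ler_pdivrMr ?expR_gt0// mul1r (le_trans _ (expR_ge1Dx _))//.
    by rewrite lerD2l ler_wpM2l ?ltW//; lra.
  have e2 : 1 + t ^+ 2 <= (1 + expR (- u)) * (1 + expR u * t ^+ 2).
    have -> : (1 + expR (- u)) * (1 + expR u * t ^+ 2) =
        1 + expR u * t ^+ 2 + expR (- u) + expR (- u) * expR u * t ^+ 2 by ring.
    rewrite -expRD addNr expR0 mul1r.
    by have := mulr_ge0 (ltW y0) t0; have := expR_ge0 (- u); lra.
  rewrite (le_trans (ler_wpM2l (expR_ge0 _) e2))// mulrCA.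
  by rewrite ler_piMr// addr_ge0 ?expR_ge0.
have iF2 t : integrableC setT (F ^~ t).
  by apply: integrableCZ; exact: integrableC_expexp.
have EG u : Efun s u * G x (2^-1 - s) = integralC setT (F u).
  pose c := expR (u / 2); have c0 : 0 < c := expR_gt0 _.
  (* The abscissa is first moved to c x, so that scaling by c brings the line back to x for every
     u. *)
  rewrite (@G_sigma_independent _ _ x (c * x))// ?mulr_gt0// GE ?mulr_gt0//.
  rewrite (@integralC_scale _ c)//; last by apply: continuousC_Gfun; rewrite mulr_gt0.
  rewrite (@eq_integralC _ _ _ (fun t => (Efun s u)^-1 * F u t)); last first.
    move=> t _; apply: (@mulfI _ (Efun s u)); first exact: expC_neq0.
    rewrite mulVKf ?expC_neq0// /F /Gfun /Efun /expexp /A /B.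
    have -> : (c * x) +i* (c * t) = c%:C * (x +i* t).
      by apply: complex_eq; rewrite !ReImE /= mul0r ?subr0 ?addr0.
    have c2 : c%:C ^+ 2 = (expR u)%:C by rewrite expr2 -realCM -expRD -splitr.
    have cE : c%:C = expC (u / 2)%:C by rewrite expC_real.
    have lc : (ln c)%:C = u%:C / 2 by rewrite expRK realCM realCV natC.
    rewrite LogC_scale// exprMn c2 lc cE realCM realCV natC -!expCD; congr expC.
    by field.
  by rewrite integralCZ// mulVKf// expC_neq0.
rewrite Euler_integralE mulrC -integralCZ; last exact: integrableC_Efun.
rewrite (@eq_integralC _ _ _ (fun u => integralC setT (F u))); last first.
  by move=> u _; rewrite mulrC EG.
(* The u-integral of this majorant is M / x / Re (B t), and Re (B t) = 1 - x ^ 2 + t ^ 2 >= (1 - x ^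
   2) (1 + t ^ 2). *)
pose H u t := M / x * expR (u - expR u * Re (B t)).
have HE t : EFin \o (H ^~ t) = (fun u => (Re ((M / x)%:C * expexp ((Re (B t))%:C) u))%:E).
  apply/funext => u; rewrite /expexp -[(expR u)%:C * _]realCM -rmorphB expC_real.
  by rewrite -[_ * (expR _)%:C]realCM.
have BR t : 0 < Re ((Re (B t))%:C) by exact: B0.
have iH t : integrableC setT (fun u => (M / x)%:C * expexp ((Re (B t))%:C) u).
  by apply: integrableCZ; exact: integrableC_expexp.
have [mF1 mF2] := measurable_expexp_param cA cB.
rewrite (@integralC_Fubini _ F H (M / x / (1 - x ^+ 2)))//.
- apply: eq_integralC => t _; rewrite integralCZ; last exact: integrableC_expexp.
  by rewrite integral_expexp.
- by move=> t; rewrite HE; case: (iH t).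
- by move=> u t; rewrite ComplexField.Normc.normcM normc_expexp ler_wpM2r ?expR_ge0.
- move=> t.
  have -> : Rintegral mu setT (H ^~ t) =
      Re (integralC setT (fun u => (M / x)%:C * expexp ((Re (B t))%:C) u)).
    rewrite /= /Rintegral; congr fine; congr integral.
    exact: HE.
  rewrite integralCZ; last exact: integrableC_expexp.
  rewrite integral_expexp// -realCV -realCM -[X in _ <= X]mulrA ler_wpM2l// -invfM.
  rewrite lef_pV2 ?posrE ?mulr_gt0 ?one_sqr_gt0 ?B0// Re_one_sub_sqr.
  by have := sqr_ge0 t; have := sqr_ge0 x; nra.
Qed.

End ReflectionFormula.

(** * The auxiliary integral that vanishes *)

Section PoissonKernel.
Context {R : realType}.
Local Notation mu := (@lebesgue_measure R).
Implicit Types (u x y t a e : R) (s z w : R[i]).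

Lemma continuousC_mul (f g : R -> R[i]) : continuousC f -> continuousC g ->
  continuousC (fun t => f t * g t).
Proof.
move=> [f1 f2] [g1 g2]; split.
  under eq_fun do rewrite ReM; move=> t.
  by apply: cvgB; apply: cvgM; [exact: f1|exact: g1|exact: f2|exact: g2].
under eq_fun do rewrite ImM; move=> t.
by apply: cvgD; apply: cvgM; [exact: f1|exact: g2|exact: f2|exact: g1].
Qed.

Lemma continuousC_real (f : R -> R) : continuous f -> continuousC (fun t => (f t)%:C).
Proof. by move=> cf; split => //= t; exact: cvg_cst. Qed.

Lemma continuousC_comp (f : R -> R[i]) (g : R -> R) : continuousC f -> continuous g ->
  continuousC (fun t => f (g t)).
Proof.
move=> [f1 f2] cg; split=> t.
- exact: (continuous_comp (cg t) (f1 (g t))).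
- exact: (continuous_comp (cg t) (f2 (g t))).
Qed.

Lemma integralC_real (f : R -> R) :
  integralC setT (fun t => (f t)%:C) = (Rintegral mu setT f)%:C.
Proof. by apply: complex_eq => //=; rewrite /Rintegral integral0. Qed.

Lemma normc_expC_NLogC w : 0 < Re w -> normc (expC (- LogC w)) = (normc w)^-1.
Proof. by move=> w0; rewrite expCN ComplexField.Normc.normcV expC_LogC. Qed.

(** Half of a Cauchy majorant: the two linear factors in the denominator of [Qfun] contribute one
    square root each. *)
Lemma normc_ge_slope (k x t : R) : 0 <= k <= 1 -> k <= x ->
  k * Num.sqrt (1 + t ^+ 2) <= normc (x +i* t).
Proof.
move=> /andP[k0 k1] kx.
rewrite -(@ler_pXn2r _ 2%N) ?nnegrE ?normc_ge0 ?mulr_ge0 ?sqrtr_ge0//.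
rewrite sqr_normc exprMn sqr_sqrtr ?(ltW (one_sqr_gt0 _))//= mulrDr mulr1.
have h1 : k ^+ 2 <= x ^+ 2 by rewrite ler_pXn2r ?nnegrE// (le_trans k0).
have h2 : k ^+ 2 <= 1 by rewrite expr_le1.
by rewrite lerD// ler_piMl// sqr_ge0.
Qed.

(** This is w ^ (1 - 2s) / ((1 + w) (w - a)). For x > a > 0 all three logarithms are taken in the
    right half-plane. *)
Definition Qfun s a x t : R[i] := expC ((1 - 2 * s) * LogC (x +i* t) -
  LogC ((1 + x) +i* t) - LogC ((x - a) +i* t)).

Definition dQfun s a x t : R[i] := Qfun s a x t *
  ((1 - 2 * s) / (x +i* t) - ((1 + x) +i* t)^-1 - ((x - a) +i* t)^-1).

Lemma derC_Qfun s a (c : R -> R[i]) t d : 0 < a -> a < Re (c t) -> derC c t d ->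
  derC (fun y => expC ((1 - 2 * s) * LogC (c y) - LogC (1 + c y) - LogC (c y - a%:C))) t
   (expC ((1 - 2 * s) * LogC (c t) - LogC (1 + c t) - LogC (c t - a%:C)) *
     (d * ((1 - 2 * s) / c t - (1 + c t)^-1 - (c t - a%:C)^-1))).
Proof.
move=> a0 ac dc; have c0 : 0 < Re (c t) by exact: lt_trans ac.
have dc1 : derC (fun y => 1 + c y) t d.
  by apply: derC_eq (derC_add (derC_cst 1 t) dc) _; rewrite add0r.
have dca : derC (fun y => c y - a%:C) t d.
  by apply: derC_eq (derC_add dc (derC_cst (- a%:C) t)) _; rewrite addr0.
apply: derC_expC.
have p1 : 0 < Re (1 + c t) by rewrite ReD /= addr_gt0.
have p2 : 0 < Re (c t - a%:C) by rewrite ReD ReN /= subr_gt0.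
have h := derC_add (derC_add (derC_mull (1 - 2 * s) (derC_LogC c0 dc))
  (derC_opp (derC_LogC p1 dc1))) (derC_opp (derC_LogC p2 dca)).
by apply: derC_eq h _; ring.
Qed.

Lemma complex_one_add x t : (1 + x) +i* t = 1 + (x +i* t).
Proof. by apply: complex_eq; rewrite ?ReD ?ImD //= add0r. Qed.

Lemma complex_sub_real x a t : (x - a) +i* t = (x +i* t) - a%:C.
Proof. by apply: complex_eq; rewrite ?ReD ?ImD ?ReN ?ImN //= oppr0 addr0. Qed.

Lemma QfunE s a x t : Qfun s a x t = expC ((1 - 2 * s) * LogC (x +i* t) -
  LogC (1 + (x +i* t)) - LogC ((x +i* t) - a%:C)).
Proof. by rewrite /Qfun complex_one_add complex_sub_real. Qed.

Lemma dQfunE s a x t : dQfun s a x t = Qfun s a x t *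
  ((1 - 2 * s) / (x +i* t) - (1 + (x +i* t))^-1 - ((x +i* t) - a%:C)^-1).
Proof. by rewrite /dQfun complex_one_add complex_sub_real. Qed.

Lemma derC_Qfun_horizontal s a x t : 0 < a -> a < x ->
  derC (fun y => Qfun s a y t) x (dQfun s a x t).
Proof.
move=> a0 ax; rewrite dQfunE.
apply: (derC_ext (fun y => esym (QfunE s a y t))); rewrite QfunE.
apply: derC_eq (derC_Qfun s a0 (c := fun y => y +i* t) ax (derC_horizontal t x)) _.
by rewrite mul1r.
Qed.

Lemma derC_Qfun_vertical s a x t : 0 < a -> a < x ->
  derC (Qfun s a x) t ('i * dQfun s a x t).
Proof.
move=> a0 ax; rewrite dQfunE.
apply: (derC_ext (fun y => esym (QfunE s a x y))); rewrite QfunE.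
apply: derC_eq (derC_Qfun s a0 (c := fun y => x +i* y) ax (derC_vertical x t)) _.
by rewrite mulrCA.
Qed.

Lemma continuousC_Qfun s a x : 0 < a -> a < x -> continuousC (Qfun s a x).
Proof.
move=> a0 ax; apply: (derC_continuousC (d := fun t => 'i * dQfun s a x t)) => t.
exact: derC_Qfun_vertical.
Qed.

Lemma continuousC_inv_vertical x : 0 < x -> continuousC (fun t => (x +i* t)^-1).
Proof.
move=> x0; apply: (continuousC_ext (f := fun t => expC (- LogC (x +i* t)))).
  by move=> t; rewrite expCN expC_LogC.
apply: (derC_continuousC (d := fun t => expC (- LogC (x +i* t)) * (- ('i / (x +i* t))))) => t.
apply: derC_expC; apply: derC_opp.
exact: (derC_LogC (c := fun y => x +i* y) x0 (derC_vertical _ _)).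
Qed.

Lemma continuousC_dQfun s a x : 0 < a -> a < x -> continuousC (dQfun s a x).
Proof.
move=> a0 ax; apply: continuousC_mul; first exact: continuousC_Qfun.
apply: (continuousC_ext (f := fun t => (1 - 2 * s) * (x +i* t)^-1 +
  (-1 * ((1 + x) +i* t)^-1 + -1 * ((x - a) +i* t)^-1))).
  by move=> t; rewrite !mulN1r addrA.
have [p1 [p2 p3]] : 0 < x /\ 0 < 1 + x /\ 0 < x - a by lra.
by apply: continuousC_add; [|apply: continuousC_add]; apply: continuousC_mull;
  exact: continuousC_inv_vertical.
Qed.

(** The factor M / x tends to 0 as the line moves right; k bounds the distance to the pole a from
    below. *)
Lemma Qfun_bounded s a x (k M : R) : 2^-1 <= a -> 0 < k <= 1 -> a + k <= x -> 0 <= M ->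
  (forall x t, 2^-1 <= x -> normc (expC ((1 - 2 * s) * LogC (x +i* t))) <= M / x) ->
  cauchy_bounded (Qfun s a x) (M / x / k).
Proof.
move=> a2 /andP[k0 k1] kx M0 hM t.
have [p1 [p2 [p3 p4]]] : 2^-1 <= x /\ 0 < x /\ 0 < 1 + x /\ 0 < x - a by lra.
have -> : normc (Qfun s a x t) = normc (expC ((1 - 2 * s) * LogC (x +i* t))) *
    ((normc ((1 + x) +i* t))^-1 * (normc ((x - a) +i* t))^-1).
  have h (u v w : R[i]) : normc (u * v * w) = normc u * (normc v * normc w).
    by rewrite !ComplexField.Normc.normcM mulrA.
  by rewrite /Qfun expCD expCD h normc_expC_NLogC// normc_expC_NLogC.
rewrite -[leRHS]mulrA.
apply: ler_pM; rewrite ?mulr_ge0 ?invr_ge0 ?normc_ge0//; first exact: hM.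
set r := Num.sqrt (1 + t ^+ 2).
have r0 : 0 < r by rewrite sqrtr_gt0 one_sqr_gt0.
have h1 : 1 * r <= normc ((1 + x) +i* t) by apply: normc_ge_slope; rewrite ?ler01 ?lexx//; lra.
have h2 : k * r <= normc ((x - a) +i* t) by apply: normc_ge_slope; [rewrite ltW|lra].
have -> : 1 + t ^+ 2 = r * r by rewrite -expr2 sqr_sqrtr// ltW// one_sqr_gt0.
rewrite -!invfM lef_pV2 ?posrE ?mulr_gt0//.
- have -> : k * (r * r) = (1 * r) * (k * r) by ring.
  by rewrite ler_pM// ?mulr_ge0// ltW.
- by rewrite (lt_le_trans _ h1)// mul1r.
- by rewrite (lt_le_trans _ h2)// mulr_gt0.
Qed.

Lemma normc_inv_le x t : 0 < x -> normc (x +i* t)^-1 <= x^-1.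
Proof.
move=> x0; have h : x <= normc (x +i* t) by rewrite (le_trans (ler_norm _))// (normc_ge_Re (x +i* t)).
by rewrite ComplexField.Normc.normcV lef_pV2 ?posrE// (lt_le_trans x0).
Qed.

Lemma integral_Qfun s a x : 1 <= Re s -> 2^-1 <= a -> a < x ->
  integralC setT (Qfun s a x) = 0.
Proof.
move=> s1 a2 ax; have a0 : 0 < a by lra.
have [M M0 hM] := normc_power_bound s1.
have shift y : a < y -> integralC setT (Qfun s a x) = integralC setT (Qfun s a y).
  move=> ay; apply: (@contour_shift _ (Qfun s a) (dQfun s a) a) => //.
  - by move=> *; exact: derC_Qfun_horizontal.
  - by move=> *; exact: derC_Qfun_vertical.
  - by move=> *; exact: continuousC_dQfun.
  move=> b c ab; pose k := Num.min 1 (b - a).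
  have k0 : 0 < k by rewrite lt_min ltr01 subr_gt0.
  have k1 : k <= 1 by rewrite ge_min lexx.
  have kb : k <= b - a by rewrite ge_min lexx orbT.
  (* [C] adds the bounds of the three terms of the logarithmic derivative; as it is at least 1, K *
     C bounds [Qfun] as well as [dQfun]. *)
  pose K := M / 2^-1 / k; pose C := normc (1 - 2 * s) * 2 + 1 + k^-1.
  have K0 : 0 <= K by rewrite !divr_ge0// ltW.
  have C1 : 1 <= C.
    have := mulr_ge0 (normc_ge0 (1 - 2 * s)) (ler0n R 2).
    by have : 0 <= k^-1 by [rewrite invr_ge0 ltW]; rewrite /C; lra.
  have bQ r : b <= r <= c -> cauchy_bounded (Qfun s a r) K.
    move=> /andP[br _] t.
    have kr : a + k <= r by lra.
    rewrite (le_trans (@Qfun_bounded s a r k M a2 _ kr M0 hM t)) ?k0//.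
    rewrite ler_wpM2r ?invr_ge0 ?(ltW (one_sqr_gt0 _))// ler_wpM2r ?invr_ge0 ?(ltW k0)//.
    by rewrite ler_wpM2l// lef_pV2 ?posrE; lra.
  exists (K * C) => r rbc; have /andP[br _] := rbc.
  have [r1 [r2 [r3 r4]]] : 2^-1 <= r /\ 0 < r /\ 1 <= 1 + r /\ k <= r - a by lra.
  split=> t.
    rewrite (le_trans (bQ r rbc t))// ler_wpM2r ?invr_ge0 ?(ltW (one_sqr_gt0 _))//.
    by rewrite ler_peMr.
  rewrite /dQfun ComplexField.Normc.normcM mulrAC.
  apply: ler_pM; rewrite ?normc_ge0//; first exact: bQ.
  rewrite (le_trans (le_normcD _ _))// lerD//.
    rewrite (le_trans (le_normcD _ _))// lerD//.
      rewrite ComplexField.Normc.normcM ler_wpM2l ?normc_ge0// (le_trans (normc_inv_le t r2))//.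
      by rewrite -[leRHS]invrK lef_pV2 ?posrE.
    rewrite normcN (le_trans (normc_inv_le t _))//; first by lra.
    by rewrite invf_le1//; lra.
  rewrite normcN (le_trans (normc_inv_le t _))//; first by lra.
  by rewrite lef_pV2 ?posrE//; lra.
have b y : a + 1 <= y -> normc (integralC setT (Qfun s a x)) <= 2 * pi * (M / y).
  move=> y1; have ay : a < y by lra.
  rewrite (shift y ay).
  have bd : cauchy_bounded (Qfun s a y) (M / y).
    by have := @Qfun_bounded s a y 1 M a2 _ y1 M0 hM; rewrite ltr01 lexx divr1; apply.
  exact: (normc_integralC_le (integrableC_bounded (continuousC_Qfun s a0 ay) bd) bd).
apply/eqP; rewrite -normc_eq0; set v := normc _ in b *.
rewrite eq_le normc_ge0 andbT leNgt; apply/negP => v0.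
(* Chosen so that v y = v (a + 1) + 2 pi M exceeds the bound 2 pi M. *)
pose y := a + 1 + 2 * pi * M / v.
have y1 : a + 1 <= y by rewrite lerDl divr_ge0 ?(ltW v0)// mulr_ge0// mulr_ge0// pi_ge0.
have y0 : 0 < y by lra.
have := b y y1; rewrite mulrA ler_pdivlMr// /y mulrDr (mulrC v (_ / v)) divfK ?gt_eqF//.
by have := mulr_gt0 v0 (_ : 0 < a + 1); lra.
Qed.

End PoissonKernel.

(** * The Poisson kernel and its limit *)

Section PoissonLimit.
Context {R : realType}.
Implicit Types (u x y t e : R) (s z w : R[i]).

(* On the line Re w = 1 - e one has
     1 / (1 - w) + 1 / (w - (1 - 2 e)) = 2 e / (e ^+ 2 + t ^+ 2),
   and the second term does not contribute to the integral. *)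
Lemma integral_poisson s e : 1 <= Re s -> 0 < e <= 4^-1 ->
  integralC setT (fun t => expC ((1 - 2 * s) * LogC ((1 - e) +i* t)) /
    (1 - ((1 - e) +i* t) ^+ 2)) =
  integralC setT (fun t => expC ((1 - 2 * s) * LogC ((1 - e) +i* (e * t)) -
    LogC ((1 + (1 - e)) +i* (e * t))) * (2 / (1 + t ^+ 2))%:C).
Proof.
move=> s1 /andP[e0 e4].
have [M M0 hM] := normc_power_bound s1.
(* The condition e <= 1/4 is what gives a >= 1/2, as the power bound requires. *)
pose x := 1 - e; pose a := 1 - 2 * e.
have [x2 [x0 [x10 [a2 [a0 ax]]]]] :
  2^-1 <= x /\ 0 < x /\ 0 < 1 + x /\ 2^-1 <= a /\ 0 < a /\ a < x by rewrite /x /a; lra.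
pose h t := expC ((1 - 2 * s) * LogC (x +i* t) - LogC ((1 + x) +i* t)).
pose P t := h t * (2 * e / (e ^+ 2 + t ^+ 2))%:C.
have q0 t : 0 < e ^+ 2 + t ^+ 2 by rewrite ltr_pwDl ?exprn_gt0 ?sqr_ge0.
have ch : continuousC h.
  apply: (derC_continuousC (d := fun t => h t * ((1 - 2 * s) * ('i / (x +i* t)) -
    'i / ((1 + x) +i* t)))) => t.
  apply: derC_expC; apply: derC_add; first exact: derC_power_vertical.
  apply: derC_opp.
  exact: (derC_LogC (c := fun y => (1 + x) +i* y) x10 (derC_vertical _ _)).
have cP : continuousC P.
  apply: continuousC_mul => //; apply: continuousC_real => t.
  apply: cvgM; first exact: cvg_cst.
  apply: cvgV; first by rewrite gt_eqF.
  apply: cvgD; first exact: cvg_cst.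
  exact: exprn_continuous.
have hb t : normc (h t) <= M / x.
  have -> : normc (h t) = normc (expC ((1 - 2 * s) * LogC (x +i* t))) *
      (normc ((1 + x) +i* t))^-1.
    by rewrite /h expCD ComplexField.Normc.normcM normc_expC_NLogC.
  rewrite -[leRHS]mulr1; apply: ler_pM; rewrite ?invr_ge0 ?normc_ge0//; first exact: hM.
  have h1 : 1 + x <= normc ((1 + x) +i* t).
    by rewrite (le_trans (ler_norm _))// (normc_ge_Re ((1 + x) +i* t)).
  by rewrite invf_le1//; lra.
have bP : cauchy_bounded P (M / x * (2 / e)).
  move=> t; rewrite /P ComplexField.Normc.normcM normc_real -[leRHS]mulrA.
  apply: ler_pM; rewrite ?normc_ge0 ?normr_ge0//.
  rewrite ger0_norm; last by rewrite divr_ge0 ?mulr_ge0 ?ltW.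
  have t0 := one_sqr_gt0 t; rewrite ler_pdivrMr//.
  have -> : 2 / e / (1 + t ^+ 2) * (e ^+ 2 + t ^+ 2) =
      2 * (e ^+ 2 + t ^+ 2) / (e * (1 + t ^+ 2)) by field; rewrite !gt_eqF.
  rewrite ler_pdivlMr ?mulr_gt0//.
  have : e ^+ 2 * t ^+ 2 <= t ^+ 2 by rewrite ler_piMl ?sqr_ge0// expr_le1//; lra.
  lra.
have iP := integrableC_bounded cP bP.
have iQ : integrableC setT (Qfun s a x).
  have bQ : cauchy_bounded (Qfun s a x) (M / x / e).
    apply: (@Qfun_bounded _ s a x e M a2 _ _ M0 hM); first by rewrite e0; lra.
    by rewrite /a /x; lra.
  exact: (integrableC_bounded (continuousC_Qfun s a0 ax) bQ).
rewrite (@eq_integralC _ _ _ (fun t => P t + -1 * Qfun s a x t)); last first.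
  move=> t _; rewrite /P /Qfun (expCD (_ - _)) -/(h t) expCN expC_LogC; last by rewrite /= /x /a; lra.
  rewrite /h expCD (expCN (LogC _)) expC_LogC//.
  have w0 : (1 + x) +i* t != 0 by exact: (Re_gt0_neq0 (z := (1 + x) +i* t)).
  have -> : (x - a) +i* t = e +i* t by congr (_ +i* _); rewrite /x /a; ring.
  have -> : 1 - ((1 - e) +i* t) ^+ 2 = ((1 + x) +i* t) * (e -i* t).
    by apply: complex_eq; rewrite !ReImE /= /x; ring.
  have -> : (2 * e / (e ^+ 2 + t ^+ 2))%:C = ((e -i* t) + (e +i* t)) / ((e -i* t) * (e +i* t)).
    rewrite realCM realCV; congr (_ / _).
      by apply: complex_eq; rewrite !ReImE /=; ring.
    by apply: complex_eq; rewrite !ReImE /=; ring.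
  have n1 : e -i* t != 0 by exact: (Re_gt0_neq0 (z := e -i* t)).
  have n2 : e +i* t != 0 by exact: (Re_gt0_neq0 (z := e +i* t)).
  by rewrite -/x; field; rewrite n1 n2 w0.
rewrite integralCD//; last exact: integrableCZ.
rewrite integralCZ// integral_Qfun// mulr0 addr0.
(* Scaling by e makes the kernel independent of e, so that dominated convergence can be applied to
   the other factor. *)
rewrite (@integralC_scale _ e)//; apply: eq_integralC => t _.
rewrite /P /h -mulrA -realCM -/x; congr (_ * _%:C).
have t0 := one_sqr_gt0 t.
have -> : e ^+ 2 + (e * t) ^+ 2 = e ^+ 2 * (1 + t ^+ 2) by ring.
by field; rewrite !gt_eqF.
Qed.

Lemma Euler_integral_mul_G_pi s (sigma : R) : 1 <= Re s -> 0 < sigma ->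
  Euler_integral s * G sigma (2^-1 - s) = pi%:C.
Proof.
move=> s1 s0; have [M M0 hM] := normc_power_bound s1.
(* Starting at 1/4 keeps every term within the range of [integral_poisson]. *)
pose e (n : nat) : R := n.+4%:R^-1.
have e0 n : 0 < e n by rewrite invr_gt0 ltr0n.
have e4 n : e n <= 4^-1 by rewrite lef_pV2 ?posrE ?ltr0n// ler_nat.
have ecv : e n @[n --> \oo] --> (0 : R).
  have := @cvg_harmonic R; rewrite -(cvg_shiftn 3).
  by apply: cvg_trans; apply: near_eq_cvg; apply: nearW => n; rewrite /e /harmonic/= addn3.
pose f n t := expC ((1 - 2 * s) * LogC ((1 - e n) +i* (e n * t)) -
    LogC ((1 + (1 - e n)) +i* (e n * t))) * (2 / (1 + t ^+ 2))%:C.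
have eq n : Euler_integral s * G sigma (2^-1 - s) = integralC setT (f n).
  have := e0 n; have := e4 n => en4 en0.
  rewrite (@G_sigma_independent _ _ sigma (1 - e n))//; last by lra.
  rewrite Euler_integral_mul_G//; last by apply/andP; split; lra.
  by rewrite integral_poisson// en0 en4.
have cvf : cvgC (fun n => integralC setT (f n))
    (integralC setT (fun t : R => ((1 + t ^+ 2)^-1)%:C)).
  (* M / x <= 2 M because x >= 1/2, |1 + w| >= 1, and the last 2 is that of the kernel. *)
  apply: (@integralC_dominated_cvg _ f _ (M * 2 * 2)).
  - move=> n; have := e0 n; have := e4 n => en4 en0.
    have [x0 x1] : 0 < 1 - e n /\ 0 < 1 + (1 - e n) by lra.
    apply: continuousC_mul.
      apply: (continuousC_comp (f := fun t => expC ((1 - 2 * s) * LogC ((1 - e n) +i* t) -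
        LogC ((1 + (1 - e n)) +i* t)))).
        apply: (derC_continuousC (d := fun t => expC ((1 - 2 * s) * LogC ((1 - e n) +i* t) -
          LogC ((1 + (1 - e n)) +i* t)) * ((1 - 2 * s) * ('i / ((1 - e n) +i* t)) -
          'i / ((1 + (1 - e n)) +i* t)))) => t.
        apply: derC_expC; apply: derC_add; first exact: derC_power_vertical.
        apply: derC_opp.
        exact: (derC_LogC (c := fun y => (1 + (1 - e n)) +i* y) x1 (derC_vertical _ _)).
      by move=> t; apply: cvgM; [exact: cvg_cst|exact: cvg_id].
    apply: continuousC_real => t; apply: cvgM; first exact: cvg_cst.
    apply: cvgV; first by rewrite gt_eqF// one_sqr_gt0.
    by apply: cvgD; [exact: cvg_cst|exact: exprn_continuous].
  - move=> t.
    have c1 : cvgC (fun n => (1 - e n) +i* (e n * t)) ((1 : R) +i* 0).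
      split => /=; first by rewrite -[X in _ --> X]subr0; apply: cvgB => //; exact: cvg_cst.
      by rewrite -(mul0r t); apply: cvgM => //; exact: cvg_cst.
    have c2 : cvgC (fun n => (1 + (1 - e n)) +i* (e n * t)) ((2 : R) +i* 0).
      case: c1 => c11 c12; split => //=.
      by rewrite -[2]/(1 + 1); apply: cvgD => //; exact: cvg_cst.
    (* The exponential is h 1 = 1/2, which cancels the 2 of the kernel. *)
    have -> : ((1 + t ^+ 2)^-1)%:C = expC ((1 - 2 * s) * LogC ((1 : R) +i* 0) +
        -1 * LogC ((2 : R) +i* 0)) * (2 / (1 + t ^+ 2))%:C.
      rewrite (@LogC_real _ 1)// ln1 mulr0 add0r mulN1r expCN expC_LogC//.
      by rewrite realCM mulKf// -/(real_complex R 2) natC pnatr_eq0.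
    apply: cvgC_mul; last exact: cvgC_cst.
    apply: cvgC_expC.
    apply: (cvgC_ext (u := fun n => (1 - 2 * s) * LogC ((1 - e n) +i* (e n * t)) +
      -1 * LogC ((1 + (1 - e n)) +i* (e n * t)))); first by move=> n; rewrite mulN1r.
    apply: cvgC_add; apply: cvgC_mul; try exact: cvgC_cst.
      exact: cvgC_LogC.
    exact: cvgC_LogC.
  - move=> n t; have := e0 n; have := e4 n => en4 en0.
    set x := 1 - e n; have [x2 [x0 x10]] : 2^-1 <= x /\ 0 < x /\ 0 < 1 + x by rewrite /x; lra.
    have -> : normc (f n t) = normc (expC ((1 - 2 * s) * LogC (x +i* (e n * t)))) *
        (normc ((1 + x) +i* (e n * t)))^-1 * (2 / (1 + t ^+ 2)).
      rewrite /f -/x ComplexField.Normc.normcM normc_real ger0_norm; last first.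
        by rewrite divr_ge0// ltW// one_sqr_gt0.
      by rewrite expCD ComplexField.Normc.normcM normc_expC_NLogC.
    rewrite -[leRHS]mulrA ler_wpM2r//; first by rewrite divr_ge0// ltW// one_sqr_gt0.
    rewrite -[leRHS]mulr1; apply: ler_pM; rewrite ?invr_ge0 ?normc_ge0//.
      rewrite (le_trans (hM x (e n * t) x2))// ler_wpM2l//.
      by rewrite -[leRHS]invrK lef_pV2 ?posrE.
    have h1 : 1 + x <= normc ((1 + x) +i* (e n * t)).
      by rewrite (le_trans (ler_norm _))// (normc_ge_Re ((1 + x) +i* (e n * t))).
    by rewrite invf_le1//; lra.
rewrite -Rintegral_cauchy_density -integralC_real; apply: cvgC_unique cvf.
by apply: (cvgC_ext eq); exact: cvgC_cst.
Qed.

End PoissonLimit.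

(** * The cosine formula in the right half-plane *)

Section CosineFormula.
Context {R : realType}.
Implicit Types (u x y t : R) (s z w : R[i]).

Lemma cvg_harmonicR : (n.+1%:R^-1 : R) @[n --> \oo] --> (0 : R).
Proof. exact: cvg_harmonic. Qed.

Lemma cvg_atan_mulnat y : 0 < y -> atan (y * n.+1%:R) @[n --> \oo] --> (pi / 2 : R).
Proof.
move=> y0; apply: (cvg_comp (fun n => y * n.+1%:R) (@atan R)); last exact: cvgy_atan.
apply/cvgryPge => A; near=> n.
rewrite mulrC -ler_pdivrMr//.
have : A / y <= n%:R by near: n; exact: nbhs_infty_ger.
by move/le_trans; apply; rewrite ler_nat.
Unshelve. all: by end_near. Qed.

(** The limits are not the values of [LogC] on the imaginary axis, where y / 0 = 0 would make the
    argument 0; the limit of the arctangent at infinity supplies pi / 2. *)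
Lemma cvgC_LogC_imaginary y : 0 < y ->
  cvgC (fun n => LogC (n.+1%:R^-1 +i* y)) (ln y +i* (pi / 2)) /\
  cvgC (fun n => LogC (n.+1%:R^-1 +i* (- y))) (ln y +i* (- (pi / 2))).
Proof.
move=> y0.
have lny : ln y = 2^-1 * ln (0 * 0 + y ^+ 2).
  by rewrite mul0r add0r lnXn//; field.
have hRe : 2^-1 * ln (n.+1%:R^-1 ^+ 2 + y ^+ 2) @[n --> \oo] --> ln y.
  rewrite lny; apply: cvgM; first exact: cvg_cst.
  apply: (cvg_seq_comp (x := fun n => n.+1%:R^-1 ^+ 2 + y ^+ 2)).
    by apply: continuous_ln; rewrite mul0r add0r exprn_gt0.
  apply: cvgD; last exact: cvg_cst.
  under eq_cvg do rewrite expr2.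
  by apply: cvgM; exact: cvg_harmonicR.
split; split => /=.
- exact: hRe.
- under eq_cvg do rewrite invrK.
  exact: cvg_atan_mulnat.
- by under eq_cvg do rewrite sqrrN.
- under eq_cvg do rewrite invrK mulNr atanN.
  by apply: cvgN; exact: cvg_atan_mulnat.
Qed.

(** [Gfun_log_bound] degenerates near the imaginary axis. Here the modulus stays explicit, so for Re
    z > 0 and x <= 1 it can be replaced by its value at x = 1. *)
Lemma normc_Gfun_le z x t : 0 < x -> 0 < Re z ->
  normc (Gfun z x t) <= expR (Re z * ln (x ^+ 2 + t ^+ 2) + pi * `|Im z| + x ^+ 2 - t ^+ 2).
Proof.
move=> x0 z0; rewrite normc_expC ler_expR !ReImE /= !mul0r addr0 subr0.
have b : `|Im z * atan (t / x)| <= pi / 2 * `|Im z|.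
  rewrite normrM mulrC ler_wpM2r// ler_norml.
  have := atan_gtNpi2 (t / x); have := atan_ltpi2 (t / x).
  by move=> *; apply/andP; split; lra.
by have := ler_norm (- (Im z * atan (t / x))); rewrite normrN; lra.
Qed.

(* Letting sigma tend to 0 in the substituted integral: for t > 0,
   (sigma +i* t) and (sigma -i* t) tend to t e^(i pi / 2) and t e^(- i pi / 2). *)
Lemma G_cosC_Euler z (sigma : R) : 0 < Re z -> 0 < sigma ->
  G sigma z = cosC (pi%:C * z) * Euler_integral (2^-1 + z).
Proof.
move=> z0 s0; pose e (n : nat) : R := n.+1%:R^-1.
have e0 n : 0 < e n by rewrite invr_gt0 ltr0n.
have e1 n : e n <= 1 by rewrite invf_le1 ?ltr0n// ler1n.
(* [Y u] is the ordinate t, and t ^ 2 = e ^ u is the variable of the Euler integral. *)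
pose Y u : R := expR (2^-1 * u).
have Y0 u : 0 < Y u := expR_gt0 _.
have Y2 u : Y u ^+ 2 = expR u.
  by rewrite /Y -expRM_natl mulVKf// pnatr_eq0.
have cY : continuous Y.
  by move=> u; exact: (is_derive_continuous (is_derive_expR_scale 2^-1 u)).
pose f n u := (Gfun z (e n) (Y u) + Gfun z (e n) (- Y u)) * (2^-1 * Y u)%:C.
have cG n : continuousC (Gfun z (e n)) by exact: continuousC_Gfun.
have cGN n : continuousC (fun t => Gfun z (e n) (- t)).
  by apply: continuousC_comp => // t; exact: opp_continuous.
have eq n : G sigma z = integralC setT (f n).
  rewrite (@G_sigma_independent _ _ sigma (e n))// GE//.
  have [K /(_ (e n))] := Gfun_bounded (e n) z (e0 n); rewrite lexx => /(_ isT) bK.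
  rewrite (integralC_halves (cG n) bK) (@integralC_expR _ 2^-1) ?invr_gt0//.
  by move=> x _; have [c1 c2] := continuousC_add (cG n) (cGN n); split; [exact: c1|exact: c2].
have i2 : 0 < 2^-1 :> R by rewrite invr_gt0.
(* The exponent 1/2 comes from the Jacobian e ^ (u / 2) / 2, and A = Re z from |w| ^ (2 Re z). *)
have [K hK] := expR_gumbel_bound i2 (ltW z0).
have cvf : cvgC (fun n => integralC setT (f n))
    (integralC setT (fun u => cosC (pi%:C * z) * Efun (2^-1 + z) u)).
  apply: (@integralC_dominated_cvg _ f _ (expR (pi * `|Im z| + 1) * K)).
  - move=> n; apply: continuousC_mul; last first.
      by apply: continuousC_real => u; apply: cvgM; [exact: cvg_cst|exact: cY].
    by apply: (continuousC_comp (f := fun t => Gfun z (e n) t + Gfun z (e n) (- t))) => //;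
      exact: continuousC_add.
  - move=> u; have [l1 l2] := cvgC_LogC_imaginary (Y0 u).
    have lnY : ln (Y u) = 2^-1 * u by rewrite expRK.
    have -> : cosC (pi%:C * z) * Efun (2^-1 + z) u =
       (expC (2 * z * (ln (Y u) +i* (pi / 2)) + ((0 : R) +i* Y u) ^+ 2) +
        expC (2 * z * (ln (Y u) +i* (- (pi / 2))) + ((0 : R) +i* (- Y u)) ^+ 2)) *
       (2^-1 * Y u)%:C.
      have -> : ((0 : R) +i* Y u) ^+ 2 = - (expR u)%:C.
        by apply: complex_eq; rewrite !ReImE /= ?Y2; ring.
      have -> : ((0 : R) +i* (- Y u)) ^+ 2 = - (expR u)%:C.
        by apply: complex_eq; rewrite !ReImE /= ?sqrrN ?Y2; ring.
      have h1 : ln (Y u) +i* (pi / 2) = (u%:C + 'i * pi%:C) / 2.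
        by rewrite half_realC; apply: complex_eq; rewrite !ReImE /= ?lnY; ring.
      have h2 : ln (Y u) +i* (- (pi / 2)) = (u%:C - 'i * pi%:C) / 2.
        by rewrite half_realC; apply: complex_eq; rewrite !ReImE /= ?lnY; ring.
      have E1 : expC (2 * z * (ln (Y u) +i* (pi / 2)) - (expR u)%:C) =
          expC (z * u%:C - (expR u)%:C) * expC ('i * (pi%:C * z)).
        by rewrite h1 -expCD; congr expC; field.
      have E2 : expC (2 * z * (ln (Y u) +i* (- (pi / 2))) - (expR u)%:C) =
          expC (z * u%:C - (expR u)%:C) * expC (- ('i * (pi%:C * z))).
        by rewrite h2 -expCD; congr expC; field.
      have E3 : Efun (2^-1 + z) u = expC (z * u%:C - (expR u)%:C) * (Y u)%:C.
        rewrite /Y -[(expR (2^-1 * u))%:C]expC_real -expCD; congr expC.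
        by rewrite realCM realCV natC; ring.
      rewrite E1 E2 E3 /cosC realCM realCV natC.
      by move: (expC _) (expC _) (expC _) => A B C; field.
    apply: cvgC_mul; last exact: cvgC_cst.
    have c1 : cvgC (fun n => e n +i* Y u) ((0 : R) +i* Y u).
      by split => /=; [exact: cvg_harmonicR|exact: cvg_cst].
    have c2 : cvgC (fun n => e n +i* (- Y u)) ((0 : R) +i* (- Y u)).
      by split => /=; [exact: cvg_harmonicR|exact: cvg_cst].
    apply: cvgC_add; apply: cvgC_expC; apply: cvgC_add.
    + by apply: cvgC_mul; [exact: cvgC_cst|exact: l1].
    + by rewrite expr2; apply: (cvgC_ext _ (cvgC_mul c1 c1)) => n; rewrite expr2.
    + by apply: cvgC_mul; [exact: cvgC_cst|exact: l2].
    + by rewrite expr2; apply: (cvgC_ext _ (cvgC_mul c2 c2)) => n; rewrite expr2.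
  - move=> n u.
    pose B := expR (Re z * ln (1 + expR u) + pi * `|Im z| + 1 - expR u).
    have b t : t ^+ 2 = expR u -> normc (Gfun z (e n) t) <= B.
      move=> t2; rewrite (le_trans (normc_Gfun_le t (e0 n) z0))// ler_expR t2.
      have e2 : e n ^+ 2 <= 1 by rewrite expr_le1// ltW.
      have p1 : 0 < e n ^+ 2 by rewrite exprn_gt0.
      have p2 := expR_gt0 u.
      have l : ln (e n ^+ 2 + expR u) <= ln (1 + expR u).
        by rewrite ler_ln ?posrE ?lerD2r// addr_gt0.
      by have := ler_wpM2l (ltW z0) l; lra.
    rewrite ComplexField.Normc.normcM normc_real ger0_norm; last first.
      by rewrite mulr_ge0 ?ltW.
    have b2 : normc (Gfun z (e n) (Y u) + Gfun z (e n) (- Y u)) <= 2 * B.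
      rewrite (le_trans (le_normcD _ _))// (_ : 2 * B = B + B); last by ring.
      by rewrite lerD// b ?sqrrN ?Y2.
    have b3 : B * Y u = expR (pi * `|Im z| + 1) *
        expR (2^-1 * u + Re z * ln (1 + expR u) - expR u).
      by rewrite /B /Y -!expRD; congr expR; ring.
    rewrite (le_trans (ler_wpM2r _ b2)) ?mulr_ge0 ?(ltW (Y0 u))//.
    have -> : 2 * B * (2^-1 * Y u) = B * Y u by field.
    by rewrite b3 -[leRHS]mulrA ler_wpM2l ?expR_ge0.
rewrite Euler_integralE -integralCZ; last first.
  by apply: integrableC_Efun; rewrite half_realC ReD /=; lra.
by apply: cvgC_unique cvf; apply: (cvgC_ext eq); exact: cvgC_cst.
Qed.

End CosineFormula.

(** * Extension to all arguments and the Gamma function *)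

Section GammaIdentities.
Context {R : realType}.
Variable sigma : R.
Hypothesis sigma_gt0 : 0 < sigma.
Implicit Types (s z : R[i]).

Lemma pi_neq0 : pi%:C != 0 :> R[i].
Proof. by apply: (Re_gt0_neq0 (z := pi%:C)); exact: pi_gt0. Qed.

Lemma G_half_sub s : G sigma (2^-1 - s) = s * G sigma (2^-1 - (s + 1)).
Proof.
have -> : 2^-1 - s = 2^-1 - (s + 1) + 1 by ring.
by rewrite G_succ//; congr (_ * _); field.
Qed.

Lemma G_half_sub_iter s n :
  G sigma (2^-1 - s) = \prod_(i < n) (s + i%:R) * G sigma (2^-1 - (s + n%:R)).
Proof.
elim: n => [|n IHn]; first by rewrite big_ord0 mul1r addr0.
by rewrite big_ord_recr /= IHn (G_half_sub (s + n%:R)) -mulrA -addrA natr1.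
Qed.

(** One step of both functional equations moves s to s + 1, whose real part is at least 1. *)
Lemma Euler_integral_mul_G_eq_pi s : 0 < Re s ->
  Euler_integral s * G sigma (2^-1 - s) = pi%:C.
Proof.
move=> s0; rewrite G_half_sub mulrCA mulrA -Euler_integral_succ//.
by rewrite Euler_integral_mul_G_pi// ReD /=; lra.
Qed.

(** At a pole the product of the s + i contains a zero factor, so G vanishes, in agreement with the
    value 0 of the right side there. *)
Lemma G_half_sub_Gamma s : G sigma (2^-1 - s) = pi%:C / Gamma s.
Proof.
rewrite /Gamma; set n := Num.truncn _.
have s0 : 0 < Re (s + n%:R).
  have := truncnS_gt (1 - Re s); rewrite -/n ReD Re_nat -natr1; lra.
have e := Euler_integral_mul_G_eq_pi s0.
have E0 : Euler_integral (s + n%:R) != 0.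
  by apply: contra_eqN e => /eqP ->; rewrite mul0r eq_sym pi_neq0.
by rewrite (G_half_sub_iter s n) -e invf_div; field.
Qed.

Lemma Gamma_eq_pi_div_G s : Gamma s = pi%:C / G sigma (2^-1 - s).
Proof. by rewrite G_half_sub_Gamma invf_div mulrC divfK// pi_neq0. Qed.

Lemma Gamma_succ s : s != 0 -> Gamma (s + 1) = s * Gamma s.
Proof.
move=> s0; rewrite !Gamma_eq_pi_div_G (G_half_sub s) invfM mulrCA; congr (_ * _).
by rewrite mulVKf.
Qed.

Lemma Gamma_Euler s : 0 < Re s -> Gamma s = Euler_integral s.
Proof.
move=> s0; rewrite /Gamma (_ : Num.truncn _ = 0%N) ?big_ord0 ?addr0 ?divr1//.
by apply/truncn0Pn; rewrite -ltNge; lra.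
Qed.

Lemma expC_imaginary (y : R) : expC ('i * y%:C) = cos y +i* sin y.
Proof.
have -> : 'i * y%:C = 0 +i* y by apply: complex_eq; rewrite !ReImE /=; ring.
by rewrite /expC /= expR0 !mul1r.
Qed.

Lemma expC_ipi : expC ('i * pi%:C) = -1 :> R[i].
Proof. by rewrite expC_imaginary cospi sinpi; apply: complex_eq => //=; rewrite oppr0. Qed.

Lemma cosC_pi_succ z : cosC (pi%:C * (z + 1)) = - cosC (pi%:C * z).
Proof.
rewrite /cosC !expCN.
have -> : 'i * (pi%:C * (z + 1)) = 'i * (pi%:C * z) + 'i * pi%:C by ring.
rewrite expCD expC_ipi mulrN1 invrN; ring.
Qed.

Lemma expC_ipi_half : expC ('i * (pi%:C * 2^-1)) = 'i :> R[i].
Proof. by rewrite half_realC -realCM expC_imaginary cos_pihalf sin_pihalf. Qed.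

Lemma cosC_sinC z : cosC (pi%:C * (z - 2^-1)) = sinC (pi%:C * z).
Proof.
rewrite /cosC /sinC !expCN.
have -> : 'i * (pi%:C * (z - 2^-1)) = 'i * (pi%:C * z) - 'i * (pi%:C * 2^-1) by ring.
rewrite expCD expCN expC_ipi_half.
have i0 : 'i%C != 0 :> R[i] by rewrite eq_complex /= oner_eq0 andbF.
have i2 : 'i%C * 'i%C = -1 :> R[i] by rewrite -expr2 sqr_i.
have := expC_neq0 ('i * (pi%:C * z)); move: (expC _) => a a0.
have iV : 'i%C^-1 = - 'i%C :> R[i] by rewrite -[RHS](mulfK i0) mulNr i2 opprK mul1r.
by rewrite !invfM invrK iV; ring.
Qed.

(** Descends from Re z > 0 in unit steps: the sign change of the cosine matches the minus sign in
    [G_succ], and off the poles the factor z + 1/2 can be cancelled. *)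
Lemma G_cosC_Gamma z : ~ Gamma_poles (2^-1 + z) ->
  G sigma z = cosC (pi%:C * z) * Gamma (2^-1 + z).
Proof.
have step w : 2^-1 + w != 0 ->
    G sigma (w + 1) = cosC (pi%:C * (w + 1)) * Gamma (2^-1 + (w + 1)) ->
    G sigma w = cosC (pi%:C * w) * Gamma (2^-1 + w).
  move=> w0; rewrite G_succ// cosC_pi_succ addrA Gamma_succ// => e.
  by apply: (mulfI w0); rewrite mulrCA -[RHS]opprK -mulNr -e; ring.
have [n] : exists n : nat, 0 < Re z + n%:R.
  by exists (Num.truncn (- Re z)).+1; have := truncnS_gt (- Re z); lra.
elim: n z => [|n IHn] z zn npole.
  rewrite addr0 in zn; rewrite (G_cosC_Euler zn)// Gamma_Euler//.
  by rewrite half_realC ReD /=; lra.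
apply: step.
  by apply/eqP => e; apply: npole; exists 0%N; rewrite e oppr0.
apply: IHn; first by move: zn; rewrite ReD -natr1 /=; lra.
(* If 1/2 + z + 1 were the pole - m, then 1/2 + z would be the pole - (m + 1). *)
move=> [m e]; apply: npole; exists m.+1.
by rewrite -(natr1 m) opprD -e; ring.
Qed.

Lemma entire_G_affine (a b c : R[i]) : normc b = 1 ->
  entire (fun z => c * G sigma (a + b * z)).
Proof.
by move=> b1; apply/entire_quadratic/quadratic_approx_affine/G_quadratic_approx.
Qed.

End GammaIdentities.

Unset Implicit Arguments.

Theorem theorem2 (R : realType) (sigma : R) (sigma_gt0 : 0 < sigma) :
  (forall z : R[i], integrableC setT (G_integrand sigma z)) /\
  ((forall s : R[i], (Gamma s)^-1 = (pi%:C)^-1 * G sigma (2^-1 - s)) /\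
   is_entire_extension (@Gamma_poles R)
     (fun s => (Gamma s)^-1)
     (fun s => (pi%:C)^-1 * G sigma (2^-1 - s))) /\
  is_entire_extension (@Gamma_poles R)
    (fun s => Gamma s * sinC (pi%:C * s))
    (fun s => G sigma (s - 2^-1)) /\
  is_entire_extension [set z | Gamma_poles (2^-1 + z)]
    (fun z => cosC (pi%:C * z) * Gamma (2^-1 + z))
    (G sigma) /\
  ((forall z : R[i], G sigma z = pi%:C / Gamma (2^-1 - z)) /\
   is_entire_extension [set z | Gamma_poles (2^-1 - z)]
     (fun z => pi%:C / Gamma (2^-1 - z))
     (G sigma)).
Proof.
have entG : entire (G sigma) := entire_quadratic (G_quadratic_approx sigma_gt0).
have G_Gamma z : G sigma z = pi%:C / Gamma (2^-1 - z).
  by rewrite -(G_half_sub_Gamma sigma_gt0) subKr.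
have Gamma_inv (s : R[i]) : (Gamma s)^-1 = (pi%:C)^-1 * G sigma (2^-1 - s).
  by rewrite (G_half_sub_Gamma sigma_gt0) mulKf// pi_neq0.
split; [|split; [|split; [|split]]].
- by move=> z; exact: integrableC_G_integrand.
- split; [exact: Gamma_inv|split; [|by move=> s _; rewrite Gamma_inv]].
  rewrite (_ : (fun s => _) = (fun s => (pi%:C)^-1 * G sigma (2^-1 + -1 * s))).
    apply: (entire_G_affine sigma_gt0); rewrite normcN.
    exact: ComplexField.Normc.normc1.
  by apply/funext => s; rewrite mulN1r.
- split.
    rewrite (_ : (fun s => _) = (fun s => 1 * G sigma (- 2^-1 + 1 * s))).
      apply: (entire_G_affine sigma_gt0); exact: ComplexField.Normc.normc1.
    by apply/funext => s; rewrite !mul1r addrC.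
  move=> s npole; rewrite (G_cosC_Gamma sigma_gt0); last by rewrite addrC subrK.
  by rewrite cosC_sinC addrC subrK mulrC.
- by split; [exact: entG|move=> z; exact: G_cosC_Gamma].
- by split; [exact: G_Gamma|split; [exact: entG|move=> z _; exact: G_Gamma]].
Qed.
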